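(* Let $(\mathcal A,\varphi)$ be a von Neumann algebra with a faithful normal tracial state, and let $x,y\in\mathcal A$. The pair $(L(x),R(y))$ of elements of $(B(L^2(\mathcal A,\varphi)),\varphi)$ is $R$-diagonal if and only if $$\varphi(p_{i_1,i_2}\,p_{i_2,i_3}\cdots p_{i_{n-1},i_n})=0$$ for all $n\ge2$, all $i_1,\dots,i_n\in\{1,2\}$ and all $p_{i_k,i_{k+1}}\in P_{i_k,i_{k+1}}(x,y)$, $k=1,\dots,n-1$, satisfying one of the following two conditions: (1) there is $0\le m\le n-1$ such that $p_{i_1,i_2},\dots,p_{i_m,i_{m+1}}$ only contain factors from $\{x,x^*\}$ and $p_{i_{m+1},i_{m+2}},\dots,p_{i_{n-1},i_n}$ only contain factors from $\{y,y^*\}$; (2) there is $1\le m\le n-1$ such that $p_{i_1,i_2},\dots,p_{i_{m-1},i_m}$ only contain factors from $\{x,x^*\}$, $p_{i_m,i_{m+1}}$ contains factors both from $\{x,x^*\}$ and from $\{y,y^*\}$, and $p_{i_{m+1},i_{m+2}},\dots,p_{i_{n-1},i_n}$ only contain factors from $\{y,y^*\}$.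
   Context: $L:\mathcal A\to B(L^2(\mathcal A,\varphi))$ and $R:\mathcal A^{op}\to B(L^2(\mathcal A,\varphi))$ are the left and right multiplication representations, $L(a)b=ab$, $R(a)b=ba$ for $b\in\mathcal A\subset L^2(\mathcal A,\varphi)$. On $B(L^2(\mathcal A,\varphi))$ one uses the state $\varphi(T)=\langle Te,e\rangle$, where $e$ is the unit of $\mathcal A$ viewed as a vector. The sets $P_{i,j}(x,y)$: consider alternating words $z=x^{\omega(1)}\cdots x^{\omega(k_1)}y^{\omega(k_1+1)}\cdots y^{\omega(k_1+k_2)}$ with $k_1,k_2\ge0$, $\omega:\{1,\dots,k_1+k_2\}\to\{1,*\}$, $\omega(i)\ne\omega(i+1)$ for all $i$. Then $P_{1,1}(x,y)$ = the set of such words $z$ with $k_1+k_2$ odd and $\omega(1)=*$; $P_{2,2}(x,y)$ = the set of such words $z$ with $k_1+k_2$ odd and $\omega(1)=1$; $P_{1,2}(x,y)$ = the set of $z-\varphi(z)$ with $z$ such a word, $k_1+k_2\ge2$ even and $\omega(1)=*$; $P_{2,1}(x,y)$ = the set of $z-\varphi(z)$ with $z$ such a word, $k_1+k_2\ge2$ even and $\omega(1)=1$. An element of $P_{i,j}(x,y)$ (with its given presentation) only contains factors from $\{x,x^*\}$ if $k_2=0$, only contains factors from $\{y,y^*\}$ if $k_1=0$, and contains both kinds if $k_1,k_2\ge1$. For $\chi:\{1,\dots,n\}\to\{l,r\}$, the permutation $s_\chi$ is defined by $\chi^{-1}(\{l\})=\{s_\chi(1)<\cdots<s_\chi(k)\}$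 and $\chi^{-1}(\{r\})=\{s_\chi(k+1)>\cdots>s_\chi(n)\}$. The set of bi-non-crossing partitions is $BNC(\chi)=\{s_\chi\cdot\pi:\pi\in NC(n)\}$ ($s_\chi$ applied to the blocks of $\pi$). The bi-free cumulants $\kappa_\chi$ are the multilinear functionals determined recursively by $\varphi(a_1\cdots a_n)=\sum_{\pi\in BNC(\chi)}\prod_{V\in\pi}\kappa_{\chi|_V}((a_1,\dots,a_n)|_V)$, where for $V=\{i_1<\dots<i_m\}$, $(a_1,\dots,a_n)|_V=(a_{i_1},\dots,a_{i_m})$ and $\chi|_V$ is relabelled order-preservingly to $\{1,\dots,m\}$. A pair $(X,Y)$ in a $*$-probability space is $R$-diagonal if, for all $\chi:\{1,\dots,m\}\to\{l,r\}$ and all $z_1,\dots,z_m$ with $z_i\in\{X,X^*\}$ when $\chi(i)=l$ and $z_i\in\{Y,Y^*\}$ when $\chi(i)=r$, one has $\kappa_\chi(z_1,\dots,z_m)=0$ unless $m=2n$ is even and $(z_{s_\chi(1)},\dots,z_{s_\chi(2n)})=(X^{\omega(1)},\dots,X^{\omega(k)},Y^{\omega(k+1)},\dots,Y^{\omega(2n)})$ for some $0\le k\le2n$ and some alternating $\omega:\{1,\dots,2n\}\to\{1,*\}$. *)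

(* Defs.v *)
From HB Require Import structures.
From mathcomp Require Import all_boot all_order all_algebra perm.
From mathcomp Require Import complex.
From mathcomp Require Import boolp classical_sets functions reals filter.
From mathcomp Require Import topology normedtype.
From mathcomp Require Import ring lra.

Set Implicit Arguments.
Unset Strict Implicit.
Unset Printing Implicit Defensive.

Import Order.TTheory GRing.Theory Num.Theory.
Import numFieldNormedType.Exports.

Local Open Scope classical_set_scope.
Local Open Scope ring_scope.

(* Complex Hilbert spaces; the inner product is linear in its first argument.
   Only nonzero spaces are considered, so that B(H) is a nontrivial ring: this
   is automatic when an algebra of operators on H, or B(H), carries a state. *)
HB.mixin Record isHilbert (R : realType) H of CompleteNormedModule R[i] H := {
  inner : H -> H -> R[i];
  inner_linear : forall w, scalar (inner^~ w);
  innerC : forall u v, inner v u = (inner u v)^*;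
  inner_norm : forall u, inner u u = `|u| ^+ 2;
  hilbert_neq0 : exists u : H, u != 0
}.

#[short(type="hilbertType")]
HB.structure Definition Hilbert (R : realType) :=
  {H of isHilbert R H & CompleteNormedModule R[i] H}.

Section HilbertTheory.
Context {R : realType} {H : hilbertType R}.
Implicit Types (u v w : H) (a : R[i]).

Lemma innerDl u v w : inner (u + v) w = inner u w + inner v w.
Proof. by have := inner_linear w 1 u v; rewrite scale1r mul1r. Qed.
Lemma inner0l w : inner 0 w = 0.
Proof. by apply: (addrI (inner 0 w)); rewrite -innerDl !addr0. Qed.
Lemma innerZl a u w : inner (a *: u) w = a * inner u w.
Proof. by have := inner_linear w a u 0; rewrite addr0 inner0l addr0. Qed.
Lemma innerBl u v w : inner (u - v) w = inner u w - inner v w.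
Proof. by rewrite innerDl -scaleN1r innerZl mulN1r. Qed.
Lemma innerDr u v w : inner w (u + v) = inner w u + inner w v.
Proof. by rewrite innerC innerDl rmorphD /= -!innerC. Qed.
Lemma innerBr u v w : inner w (u - v) = inner w u - inner w v.
Proof. by rewrite innerC innerBl rmorphB /= -!innerC. Qed.
Lemma innerZr a u w : inner w (a *: u) = a^* * inner w u.
Proof. by rewrite innerC innerZl rmorphM /= -innerC. Qed.
Lemma inner0r w : inner w 0 = 0.
Proof. by rewrite innerC inner0l conjC0. Qed.

Lemma inner_eq0 u : inner u u = 0 -> u = 0.
Proof. by rewrite inner_norm => /eqP; rewrite expf_eq0 normr_eq0 => /eqP. Qed.

Lemma inner_extl u v : (forall w, inner u w = inner v w) -> u = v.
Proof.
move=> e; apply/eqP; rewrite -subr_eq0; apply/eqP/inner_eq0.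
by rewrite innerBl e subrr.
Qed.

Lemma inner_extr u v : (forall w, inner w u = inner w v) -> u = v.
Proof. by move=> e; apply: inner_extl => w; rewrite innerC e -innerC. Qed.

Lemma near_inner (d e : R[i]) u w : 0 <= d ->
  (forall a, d <= `|w - a *: u| ^+ 2) -> `|w| ^+ 2 <= d + e ->
  `|inner w u| ^+ 2 <= e * `|u| ^+ 2.
Proof.
move=> d0 dP we.
have [->|u0] := eqVneq u 0; first by rewrite inner0r !normr0 !expr0n /= mulr0.
have nu : 0 < `|u| ^+ 2 by rewrite exprn_gt0// normr_gt0.
pose c := inner w u / `|u| ^+ 2.
have := dP c.
have -> : `|w - c *: u| ^+ 2 = `|w| ^+ 2 - `|inner w u| ^+ 2 / `|u| ^+ 2.
  rewrite -!inner_norm innerBl !innerBr !innerZl !innerZr inner_norm.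
  rewrite (innerC w u) !inner_norm normCK /c rmorphM /= fmorphV /=.
  have -> : (`|u| ^+ 2)^* = `|u| ^+ 2.
    by apply/CrealP; rewrite realE ltW.
  have nu0 : `|u| ^+ 2 != 0 by rewrite gt_eqF.
  set p := inner w u; set q := p^*; set n := `|u| ^+ 2 in nu0 *.
  by clearbody p q n; field.
move=> h; rewrite -ler_pdivrMr //.
have : d <= d + e - `|inner w u| ^+ 2 / `|u| ^+ 2 by apply: (le_trans h); rewrite lerD2r.
by rewrite -addrA lerDl subr_ge0.
Qed.

Lemma cauchy_schwarz u w : `|inner w u| <= `|w| * `|u|.
Proof.
rewrite -(@ler_pXn2r _ 2) ?nnegrE ?mulr_ge0 // exprMn.
by apply: (@near_inner 0) => // *; rewrite ?exprn_ge0 // add0r.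
Qed.

Lemma parallelogram u v :
  `|u + v| ^+ 2 + `|u - v| ^+ 2 = 2 * (`|u| ^+ 2 + `|v| ^+ 2).
Proof.
by rewrite -!inner_norm innerBl !innerBr innerDl !innerDr; ring.
Qed.


(* The representing vector is the normalised point of least norm of {f = 1}. *)
Lemma riesz (f : H -> R[i]) : scalar f ->
  (exists M, forall v, `|f v| <= M * `|v|) ->
  exists u, forall v, f v = inner v u.
Proof.
move=> fl [M fM].
have f0 : f 0 = 0 by apply: (addrI (f 0)); have := fl 1 0 0; rewrite scale1r mul1r !addr0.
have fZ a v : f (a *: v) = a * f v by have := fl a v 0; rewrite f0 !addr0.
have fD u v : f (u + v) = f u + f v by have := fl 1 u v; rewrite scale1r mul1r.
have fB u v : f (u - v) = f u - f v by rewrite fD -scaleN1r fZ mulN1r.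
have [fz|/existsNP[v0 fv0]] := pselect (forall v, f v = 0).
  by exists 0 => v; rewrite fz inner0r.
pose S := [set v | f v = 1].
have S0 : S !=set0.
  by exists ((f v0)^-1 *: v0); rewrite /S /= fZ mulVf //; apply/eqP.
pose q (v : H) : R := complex.Re (`|v| ^+ 2).
have qE v : (q v)%:C%C = `|v| ^+ 2 by rewrite /q RRe_real // realX // realE normr_ge0.
pose d := inf (q @` S).
have qinf : has_inf (q @` S).
  split; first by case: S0 => v Sv; exists (q v), v.
  by exists 0 => _ [v _ <-]; rewrite -lecR qE exprn_ge0.
have dle v : S v -> d%:C%C <= `|v| ^+ 2.
  move=> Sv; rewrite -qE lecR; apply: ge_inf; last by exists v.
  by case: qinf.
have d0 : 0 <= d%:C%C :> R[i].
  rewrite ler0c; apply: lb_le_inf; first by case: qinf.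
  by move=> _ [v _ <-]; rewrite -lecR qE exprn_ge0.
pose B (e : R) := [set v | S v /\ `|v| ^+ 2 <= d%:C%C + e%:C%C].
have B0 e : 0 < e -> B e !=set0.
  move=> e0; have [_ [v Sv <-]] := inf_adherent e0 qinf.
  by move=> /ltW h; exists v; split=> //; rewrite -qE -rmorphD /= lecR.
pose F := filter_from [set e : R | 0 < e] B.
have FF : ProperFilter F.
  apply: filter_from_proper; last by move=> e /B0.
  apply: filter_from_filter; first by exists 1; rewrite /= ltr01.
  move=> e1 e2 /= h1 h2; exists (Num.min e1 e2); first by rewrite /= lt_min h1.
  move=> v [Sv hv]; split; split=> //; apply: (le_trans hv);
    by rewrite lerD2l lecR ge_min lexx ?orbT.
have Bdist e v w : B e v -> B e w -> `|v - w| ^+ 2 <= 4 * e%:C%C.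
  move=> [Sv hv] [Sw hw].
  have Sm : S (2^-1 *: (v + w)) by rewrite /S /= fZ fD Sv Sw mulVf // pnatr_eq0.
  have := dle _ Sm; rewrite normrZ exprMn normfV exprVn normr_nat ler_pdivlMl ?exprn_gt0 ?ltr0n//.
  move=> h; have p := parallelogram v w.
  have -> : `|v - w| ^+ 2 = 2 * (`|v| ^+ 2 + `|w| ^+ 2) - `|v + w| ^+ 2.
    by rewrite -p; ring.
  rewrite lerBlDr; apply: le_trans (lerD (lexx _) h).
  apply: (@le_trans _ _ (2 * ((d%:C%C + e%:C%C) + (d%:C%C + e%:C%C)))).
    by rewrite ler_pM2l ?ltr0n// lerD.
  by rewrite le_eqVlt; apply/orP; left; apply/eqP; ring.
have Fc : cauchy F.
  apply/cauchy_exP => e e0.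
  have er : (complex.Re e)%:C%C = e by rewrite RRe_real // gtr0_real.
  have e'0 : 0 < complex.Re e ^+ 2 / 8 by rewrite divr_gt0 ?ltr0n// exprn_gt0// -ltcR er.
  have [v Bv] := B0 _ e'0; exists v, (complex.Re e ^+ 2 / 8) => //= w Bw.
  rewrite -ball_normE /= -(@ltr_pXn2r _ 2) ?nnegrE ?normr_ge0 ?ltW//.
  apply: (le_lt_trans (Bdist _ _ _ Bv Bw)).
  rewrite -er -[4]/(4%:R) -(rmorph_nat (real_complex R)) -rmorphM -rmorphXn /= ltcR.
  have : 0 < complex.Re e by rewrite -ltcR er.
  by move=> ?; nra.
have Fl : F --> lim F by apply/cauchy_cvgP.
set l := lim F in Fl.
have lP (e : R) : 0 < e -> exists2 v, B (e ^+ 2) v & `|l - v| < e%:C%C.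
  move=> e0; have Fb : F (ball l e%:C%C) by apply: Fl; apply: nbhsx_ballx; rewrite ltcR.
  have Fe : F (B (e ^+ 2)) by exists (e ^+ 2) => //=; rewrite exprn_gt0.
  have [v [Bv]] := filter_ex (filterI Fe Fb).
  by rewrite -ball_normE /= => lv; exists v.
have small (c K : R[i]) : 0 < K -> (forall e : R, 0 < e -> `|c| <= K * e%:C%C) -> c = 0.
  move=> K0 h; apply/eqP/negPn/negP => c0.
  have e0 : 0 < `|c| / (2 * K) by rewrite divr_gt0 ?mulr_gt0 ?normr_gt0.
  have er : (complex.Re (`|c| / (2 * K)))%:C%C = `|c| / (2 * K) by rewrite RRe_real // gtr0_real.
  have := h (complex.Re (`|c| / (2 * K))); rewrite -ltcR er => /(_ e0).
  have -> : K * (`|c| / (2 * K)) = `|c| / 2 by field; rewrite gt_eqF.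
  rewrite ler_pdivlMr // ger_pMr ?normr_gt0 //.
  by rewrite lern1.
have fl1 : f l = 1.
  apply/eqP; rewrite -subr_eq0; apply/eqP/(small _ (`|M| + 1)).
    by rewrite ltr_wpDl.
  move=> e /lP[v [Sv _] lv]; have -> : f l - 1 = f (l - v) by rewrite fB Sv.
  apply: (le_trans (fM _)).
  have M1 : M <= `|M| + 1.
    have [Mr|Mr] := boolP (M \is Num.real).
      by rewrite (le_trans (real_ler_norm Mr)) // lerDl.
    have [v1 v1P] : exists v1 : H, v1 != 0 by exists v0; apply/eqP => v00; apply: fv0; rewrite v00.
    have h : 0 <= M * `|v1| by apply: le_trans (fM v1).
    move: Mr; rewrite realE; move: h; rewrite pmulr_lge0 ?normr_gt0 //.
    by move=> ->.
  apply: (@le_trans _ _ ((`|M| + 1) * `|l - v|)); first by rewrite ler_wpM2r.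
  by rewrite ler_wpM2l ?addr_ge0 // ltW.
have lorth w : f w = 0 -> inner l w = 0.
  move=> fw; apply: (small _ (2 * `|w| + 1)); first by rewrite ltr_wpDl // mulr_ge0.
  move=> e e0; have [v [Sv vB] lv] := lP e e0.
  have e0' : 0 <= e%:C%C :> R[i] by rewrite ler0c ltW.
  have h1 : `|inner v w| <= e%:C%C * `|w|.
    rewrite -(@ler_pXn2r _ 2) ?nnegrE ?mulr_ge0 // exprMn.
    have -> : e%:C%C ^+ 2 = (e ^+ 2)%:C%C :> R[i] by rewrite rmorphXn.
    apply: (@near_inner d%:C%C) => // a; apply: dle.
    by rewrite /S /= fB fZ fw mulr0 subr0.
  have -> : inner l w = inner v w + inner (l - v) w by rewrite -innerDl addrC subrK.
  apply: (le_trans (ler_normD _ _)); apply: (le_trans (lerD h1 (cauchy_schwarz _ _))).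
  have h2 : `|l - v| * `|w| <= e%:C%C * `|w| by rewrite ler_wpM2r // ltW.
  apply: (le_trans (lerD (lexx _) h2)).
  have -> : (2 * `|w| + 1) * e%:C%C = e%:C%C * `|w| + e%:C%C * `|w| + e%:C%C by ring.
  by rewrite lerDl.
have l0 : inner l l != 0.
  by apply/eqP => /inner_eq0 l0; move: fl1; rewrite l0 f0 => /esym/eqP; rewrite oner_eq0.
exists (((inner l l)^*)^-1 *: l) => v.
rewrite innerZr fmorphV /= conjCK.
have /lorth : f (v - f v *: l) = 0 by rewrite fB fZ fl1 mulr1 subrr.
rewrite innerC => /(congr1 (@Num.conj _)); rewrite conjCK conjC0 innerBl innerZl.
by move=> /eqP; rewrite subr_eq0 => /eqP ->; rewrite mulrC mulfK.
Qed.

End HilbertTheory.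

(* Unital complex *-algebras *)
HB.mixin Record isStarAlgebra (C : numClosedFieldType) A
    of GRing.Algebra C A := {
  star : A -> A;
  starK : involutive star;
  starD : {morph star : x y / x + y};
  starZ : forall (a : C) (x : A), star (a *: x) = a^* *: star x;
  starM : forall x y : A, star (x * y) = star y * star x
}.

#[short(type="starAlgType")]
HB.structure Definition StarAlgebra (C : numClosedFieldType) :=
  {A of isStarAlgebra C A & GRing.Algebra C A}.

Definition is_state (C : numClosedFieldType) (A : starAlgType C)
    (phi : A -> C) : Prop :=
  [/\ scalar phi, phi 1 = 1 & forall a, 0 <= phi (star a * a)].

Section BoundedOperators.
Context {R : realType} {H : hilbertType R}.

(* The algebra B(H) of bounded operators *)
Record bop := Bop {
  bop_fun :> H -> H;
  bop_linear : linear bop_fun;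
  bop_continuous : continuous bop_fun
}.

Lemma bopP (S T : bop) : (forall v, S v = T v) -> S = T.
Proof.
case: S T => [s sl sc] [t tl tc] /= /funext st; case: _ / st in tl tc *.
by congr Bop; exact: Prop_irrelevance.
Qed.

HB.instance Definition _ := gen_eqMixin bop.
HB.instance Definition _ := gen_choiceMixin bop.
HB.instance Definition _ (T : bop) :=
  GRing.isLinear.Build R[i] H H *:%R T (bop_linear (T : bop)).

Let zero_linear : linear (fun _ : H => 0 : H).
Proof. by move=> a u v; rewrite scaler0 addr0. Qed.
Let zero_continuous : continuous (fun _ : H => 0 : H).
Proof. by move=> v; exact: cvg_cst. Qed.
Definition bop_zero := Bop zero_linear zero_continuous.

Let one_linear : linear (@id H). Proof. by []. Qed.
Let one_continuous : continuous (@id H). Proof. by move=> v. Qed.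
Definition bop_one := Bop one_linear one_continuous.

Let add_linear (S T : bop) : linear (fun v => S v + T v).
Proof. by move=> a u v; rewrite !linearP scalerDr addrACA. Qed.
Let add_continuous (S T : bop) : continuous (fun v => S v + T v).
Proof. by move=> v; apply: cvgD; exact: bop_continuous. Qed.
Definition bop_add S T := Bop (@add_linear S T) (@add_continuous S T).

Let opp_linear (T : bop) : linear (fun v => - T v).
Proof. by move=> a u v; rewrite linearP opprD scalerN. Qed.
Let opp_continuous (T : bop) : continuous (fun v => - T v).
Proof. by move=> v; apply: cvgN; exact: bop_continuous. Qed.
Definition bop_opp T := Bop (@opp_linear T) (@opp_continuous T).

Let scale_linear (c : R[i]) (T : bop) : linear (fun v => c *: T v).
Proof. by move=> a u v; rewrite linearP scalerDr !scalerA mulrC. Qed.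
Let scale_continuous (c : R[i]) (T : bop) : continuous (fun v => c *: T v).
Proof. by move=> v; apply: cvgZl_tmp; exact: bop_continuous. Qed.
Definition bop_scale c T := Bop (@scale_linear c T) (@scale_continuous c T).

Let mul_linear (S T : bop) : linear (fun v => S (T v)).
Proof. by move=> a u v; rewrite !linearP. Qed.
Let mul_continuous (S T : bop) : continuous (fun v => S (T v)).
Proof. by move=> v; apply: continuous_comp; exact: bop_continuous. Qed.
Definition bop_mul S T := Bop (@mul_linear S T) (@mul_continuous S T).

Let addA : associative bop_add.
Proof. by move=> S T U; apply: bopP => v /=; rewrite addrA. Qed.
Let addC : commutative bop_add.
Proof. by move=> S T; apply: bopP => v /=; rewrite addrC. Qed.
Let add0 : left_id bop_zero bop_add.
Proof. by move=> T; apply: bopP => v /=; rewrite add0r. Qed.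
Let addN : left_inverse bop_zero bop_opp bop_add.
Proof. by move=> T; apply: bopP => v /=; rewrite addNr. Qed.
HB.instance Definition _ := GRing.isZmodule.Build bop addA addC add0 addN.

Let mulA : associative bop_mul.
Proof. by move=> S T U; apply: bopP. Qed.
Let mul1 : left_id bop_one bop_mul.
Proof. by move=> T; apply: bopP. Qed.
Let mul1r : right_id bop_one bop_mul.
Proof. by move=> T; apply: bopP. Qed.
Let mulDl : left_distributive bop_mul +%R.
Proof. by move=> S T U; apply: bopP. Qed.
Let mulDr : right_distributive bop_mul +%R.
Proof. by move=> S T U; apply: bopP => v /=; rewrite linearD. Qed.
Let one_neq0 : bop_one != 0.
Proof.
have [v v0] := @hilbert_neq0 R H; apply: contraNN v0 => /eqP e.
by rewrite -[v]/(bop_one v) e.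
Qed.
HB.instance Definition _ :=
  GRing.Zmodule_isNzRing.Build bop mulA mul1 mul1r mulDl mulDr one_neq0.

Let scaleA a b T : bop_scale a (bop_scale b T) = bop_scale (a * b) T.
Proof. by apply: bopP => v /=; rewrite scalerA. Qed.
Let scale1 : left_id 1 bop_scale.
Proof. by move=> T; apply: bopP => v /=; rewrite scale1r. Qed.
Let scaleDr : right_distributive bop_scale +%R.
Proof. by move=> a S T; apply: bopP => v /=; rewrite scalerDr. Qed.
Let scaleDl T : {morph bop_scale^~ T : a b / a + b}.
Proof. by move=> a b; apply: bopP => v /=; rewrite scalerDl. Qed.
HB.instance Definition _ :=
  GRing.Zmodule_isLmodule.Build R[i] bop scaleA scale1 scaleDr scaleDl.

Let scaleAl a (S T : bop) : a *: (S * T) = (a *: S) * T.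
Proof. exact: bopP. Qed.
HB.instance Definition _ := GRing.Lmodule_isLalgebra.Build R[i] bop scaleAl.
Let scaleAr a (S T : bop) : a *: (S * T) = S * (a *: T).
Proof. by apply: bopP => v; rewrite [RHS](linearZ_LR S). Qed.
HB.instance Definition _ := GRing.Lalgebra_isAlgebra.Build R[i] bop scaleAr.

Lemma bopDE (S T : bop) v : (S + T) v = S v + T v. Proof. by []. Qed.
Lemma bopNE (T : bop) v : (- T) v = - T v. Proof. by []. Qed.
Lemma bopZE a (T : bop) v : (a *: T) v = a *: T v. Proof. by []. Qed.
Lemma bopME (S T : bop) v : (S * T) v = S (T v). Proof. by []. Qed.
Lemma bop0E v : (0 : bop) v = 0. Proof. by []. Qed.
Lemma bop1E v : (1 : bop) v = v. Proof. by []. Qed.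

Lemma bop_bounded (T : bop) :
  exists2 M : R[i], 0 <= M & forall v, `|T v| <= M * `|v|.
Proof.
have /linear_bounded_continuous/linear_boundedP Tb := @bop_continuous T.
near (+oo : set_system R[i]) => r; exists r; last by near: r.
by near: r; apply: nbhs_pinfty_ge.
Unshelve. all: by end_near. Qed.

Lemma adjoint_exists (T : bop) :
  exists S : bop, forall u v, inner (T u) v = inner u (S v).
Proof.
have [M M0 TM] := bop_bounded T.
have rieszT v : exists s, forall u, inner (T u) v = inner u s.
  apply: riesz.
    by move=> a u w; rewrite linearP innerDl innerZl.
  exists (M * `|v|) => u; apply: (le_trans (cauchy_schwarz _ _)).
  by rewrite mulrAC ler_wpM2r.
have [s sP] := choice rieszT.
have sl : linear s.
  move=> a u v; apply: inner_extr => w.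
  by rewrite -sP !innerDr !innerZr -!sP.
have sM v : `|s v| <= M * `|v|.
  have [->|sv0] := eqVneq (s v) 0; first by rewrite normr0 mulr_ge0.
  rewrite -(@ler_pM2l _ `|s v|) ?normr_gt0 // -expr2 -inner_norm -sP.
  have h : 0 <= inner (T (s v)) v by rewrite sP inner_norm exprn_ge0.
  rewrite -(ger0_norm h); apply: (le_trans (cauchy_schwarz _ _)).
  by rewrite mulrA [`|s v| * M]mulrC ler_wpM2r.
pose sL := GRing.isLinear.Build R[i] H H *:%R s sl.
pose s' : {linear H -> H} := HB.pack s sL.
have sc : continuous s.
  apply: (@bounded_linear_continuous _ _ _ s'); apply/linear_boundedP.
  near=> r => v; apply: (le_trans (sM v)); rewrite ler_wpM2r //.
  by near: r; apply: nbhs_pinfty_ge; rewrite realE M0.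
by exists (Bop sl sc).
Unshelve. all: by end_near. Qed.

Definition adjoint (T : bop) : bop := projT1 (cid (adjoint_exists T)).

Lemma adjointP (T : bop) u v : inner (T u) v = inner u (adjoint T v).
Proof. by rewrite /adjoint; case: cid => S. Qed.

Lemma adjoint_unique (T S : bop) :
  (forall u v, inner (T u) v = inner u (S v)) -> adjoint T = S.
Proof.
by move=> TS; apply: bopP => v; apply: inner_extr => u; rewrite -adjointP.
Qed.

Let adjointK : involutive adjoint.
Proof.
by move=> T; apply: adjoint_unique => u v; rewrite innerC -adjointP -innerC.
Qed.
Let adjointD : {morph adjoint : S T / S + T}.
Proof.
move=> S T; apply: adjoint_unique => u v.
by rewrite !bopDE innerDl innerDr !adjointP.
Qed.
Let adjointZ a (T : bop) : adjoint (a *: T) = a^* *: adjoint T.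
Proof.
apply: adjoint_unique => u v.
by rewrite !bopZE innerZl innerZr conjCK adjointP.
Qed.
Let adjointM (S T : bop) : adjoint (S * T) = adjoint T * adjoint S.
Proof. by apply: adjoint_unique => u v; rewrite !bopME !adjointP. Qed.
HB.instance Definition _ := isStarAlgebra.Build R[i] bop
  adjointK adjointD adjointZ adjointM.

Definition vector_state (e : H) (T : bop) : R[i] := inner (T e) e.

Lemma vector_stateP (e : H) : inner e e = 1 -> is_state (vector_state e).
Proof.
move=> e1; split => [a S T||T]; rewrite /vector_state.
- by rewrite bopDE bopZE innerDl innerZl.
- by rewrite bop1E.
- by rewrite bopME innerC -adjointP -innerC inner_norm exprn_ge0.
Qed.

End BoundedOperators.
Arguments bop {R} H.

Section VonNeumann.
Context {R : realType}.

Definition commutant (H : hilbertType R) (S : set (bop H)) : set (bop H) :=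
  [set T | forall U, S U -> T * U = U * T].

(* A self-adjoint set of operators equal to its bicommutant is a weakly closed
   unital *-subalgebra of B(H). *)
Record vonNeumann (H : hilbertType R) := VonNeumann {
  vn_set : set (bop H);
  vn_star : forall T, vn_set T -> vn_set (star T);
  vn_bicommutant : commutant (commutant vn_set) = vn_set
}.

Context {H : hilbertType R} (A : vonNeumann H).

Definition vn_pred : {pred bop H} := [pred T | T \in vn_set A].

Lemma vn_predP T :
  reflect (forall U, commutant (vn_set A) U -> T * U = U * T) (T \in vn_pred).
Proof.
apply: (iffP idP) => [/set_mem|TA]; rewrite ?inE -{1}vn_bicommutant //.
Qed.

Let vn_subalg : GRing.subsemialg_closed vn_pred.
Proof.
split=> [||a T /vn_predP TP|S T /vn_predP SP /vn_predP TP].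
- by apply/vn_predP => U _; rewrite mul1r mulr1.
- split=> [|S T /vn_predP SP /vn_predP TP]; apply/vn_predP => U UA.
    by rewrite mul0r mulr0.
  by rewrite mulrDl mulrDr SP // TP.
- by apply/vn_predP => U UA; rewrite -scalerAl -scalerAr TP.
- by apply/vn_predP => U UA; rewrite -mulrA TP // mulrA SP // mulrA.
Qed.
HB.instance Definition _ :=
  GRing.isSubalgClosed.Build R[i] (bop H) vn_pred vn_subalg.

Record vn_elt := VnElt { vn_val : bop H; vn_valP : vn_val \in vn_pred }.

HB.instance Definition _ := [isSub for vn_val].
HB.instance Definition _ := [Choice of vn_elt by <:].
HB.instance Definition _ := [SubChoice_isSubAlgebra of vn_elt by <:].

Let vn_star_mem (T : vn_elt) : star (vn_val T) \in vn_pred.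
Proof. by case: T => T /= /set_mem TA; apply/mem_set/vn_star. Qed.
Definition vn_elt_star (T : vn_elt) : vn_elt := VnElt (vn_star_mem T).

Let vn_starK : involutive vn_elt_star.
Proof. by move=> T; apply: val_inj; exact: starK. Qed.
Let vn_starD : {morph vn_elt_star : S T / S + T}.
Proof. by move=> S T; apply: val_inj; exact: starD. Qed.
Let vn_starZ (a : R[i]) (T : vn_elt) :
  vn_elt_star (a *: T) = a^* *: vn_elt_star T.
Proof. by apply: val_inj; exact: starZ. Qed.
Let vn_starM (S T : vn_elt) :
  vn_elt_star (S * T) = vn_elt_star T * vn_elt_star S.
Proof. by apply: val_inj; exact: starM. Qed.
HB.instance Definition _ := isStarAlgebra.Build R[i] vn_elt
  vn_starK vn_starD vn_starZ vn_starM.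

End VonNeumann.
Coercion vn_elt : vonNeumann >-> Sortclass.

Section Traces.
Context {R : realType} {H : hilbertType R} {A : vonNeumann H}.
Implicit Types (phi : A -> R[i]) (S T U : A).

(* Comparison in R[i] forces <(T - S) v, v> to be real, so that vn_le S T says
   that T - S is a positive operator. *)
Definition vn_le S T :=
  forall v : H, inner (vn_val S v) v <= inner (vn_val T v) v.

Definition is_faithful phi := forall T, phi (star T * T) = 0 -> T = 0.

Definition is_tracial phi := forall S T, phi (S * T) = phi (T * S).

(* Preservation of the suprema of upward directed sets of self-adjoint elements;
   R[i] is partially ordered, with a <= b when b - a is a nonnegative real. *)
Definition is_normal phi := forall (D : set A) (T : A),
  D !=set0 ->
  (forall S, D S -> star S = S) ->
  (forall S1 S2, D S1 -> D S2 -> exists2 S, D S & vn_le S1 S /\ vn_le S2 S) ->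
  (forall S, D S -> vn_le S T) ->
  (forall U, (forall S, D S -> vn_le S U) -> vn_le T U) ->
  supremums (phi @` D) (phi T).

(* K is the completion of A for <a, b> = phi (b^* a), with iota the inclusion. *)
Definition is_L2 phi (K : hilbertType R) (iota : A -> K) :=
  [/\ linear iota,
      forall S T, inner (iota S) (iota T) = phi (star T * S) &
      dense (range iota)].

Definition left_mult (K : hilbertType R) (iota : A -> K) (L : A -> bop K) :=
  forall a b, L a (iota b) = iota (a * b).

Definition right_mult (K : hilbertType R) (iota : A -> K) (Rm : A -> bop K) :=
  forall a b, Rm a (iota b) = iota (b * a).

End Traces.

Variant side := lft | rgt.
Definition is_lft (s : side) : bool := if s is lft then true else false.

Section BNC.
Variable n : nat.

Definition noncrossing (P : {set {set 'I_n}}) : bool :=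
  [forall V in P, forall W in P, (V != W) ==>
    ~~ [exists a : 'I_n, exists b : 'I_n, exists c : 'I_n, exists d : 'I_n,
         [&& (a < b)%N, (b < c)%N, (c < d)%N,
             a \in V, c \in V, b \in W & d \in W]]].

Definition NC : {set {set {set 'I_n}}} :=
  [set P : {set {set 'I_n}} | finset.partition P [set: 'I_n] && noncrossing P]%SET.

(* The sequence s_chi(1), ..., s_chi(n) *)
Definition chi_seq (chi : 'I_n -> side) : seq 'I_n :=
  [seq i <- enum 'I_n | is_lft (chi i)] ++
  rev [seq i <- enum 'I_n | ~~ is_lft (chi i)].

Lemma perm_chi_seq chi : perm_eq (chi_seq chi) (enum 'I_n).
Proof.
rewrite /chi_seq perm_sym -(perm_filterC (fun i => is_lft (chi i))).
by rewrite perm_cat2l perm_sym perm_rev.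
Qed.

Lemma size_chi_seq chi : size (chi_seq chi) = n.
Proof. by rewrite (perm_size (perm_chi_seq chi)) size_enum_ord. Qed.

Lemma chi_seq_inj chi : injective (fun i : 'I_n => nth i (chi_seq chi) i).
Proof.
move=> i j /=; rewrite (set_nth_default i j) ?size_chi_seq // => /eqP.
rewrite nth_uniq ?size_chi_seq // => [/eqP/val_inj//|].
by rewrite (perm_uniq (perm_chi_seq chi)) enum_uniq.
Qed.

Definition s_chi (chi : 'I_n -> side) : 'S_n := perm (@chi_seq_inj chi).

Definition BNC (chi : 'I_n -> side) : {set {set {set 'I_n}}} :=
  [set [set s_chi chi @: V | V : {set 'I_n} in P] | P : {set {set 'I_n}} in NC]%SET.

Lemma BNC_partition chi P : P \in BNC chi -> finset.partition P [set: 'I_n]%SET.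
Proof.
case/imsetP => Q; rewrite inE => /andP[Qp _] ->.
have -> : [set: 'I_n]%SET = (s_chi chi @: [set: 'I_n])%SET.
  apply/setP => i; rewrite inE; apply/esym/imsetP.
  by exists ((s_chi chi)^-1%g i); rewrite ?inE // permKV.
by rewrite imset_partition //; exact: perm_inj.
Qed.

Lemma BNC_setT chi : (0 < n)%N -> [set [set: 'I_n]]%SET \in BNC chi.
Proof.
move=> n0; apply/imsetP; exists [set [set: 'I_n]]%SET; last first.
  rewrite imset_set1; congr [set _]%SET.
  apply/setP => i; rewrite inE; apply/esym/imsetP.
  by exists ((s_chi chi)^-1%g i); rewrite ?inE // permKV.
rewrite inE /finset.partition /finset.cover big_set1 eqxx /= finset.trivIset1 /= inE.
apply/andP; split.
  by apply/eqP => /setP/(_ (Ordinal n0)); rewrite !inE.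
apply/'forall_implyP => V; rewrite inE => /eqP ->.
by apply/'forall_implyP => W; rewrite inE => /eqP ->; rewrite eqxx.
Qed.

Lemma partition_block_lt (P : {set {set 'I_n}}) (V : {set 'I_n}) :
  finset.partition P [set: 'I_n]%SET -> P != [set [set: 'I_n]]%SET -> V \in P ->
  (0 < #|V| < n)%N.
Proof.
move=> Pp PT VP; rewrite card_gt0 (finset.partition_neq0 Pp VP) /=.
have cV' : (#|V| <= n)%N by have := max_card (mem V); rewrite card_ord.
rewrite ltn_neqAle cV' andbT.
apply: contraNN PT => /eqP cV.
have VT : V = [set: 'I_n]%SET.
  by apply/eqP; rewrite eqEcard finset.subsetT cardsT card_ord cV /=.
apply/eqP/setP => W; rewrite inE; apply/idP/eqP => [WP|->]; last by rewrite -VT.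
apply/eqP; rewrite -VT; apply/negPn/negP => WV.
have /finset.trivIsetP/(_ W V WP VP WV) := finset.partition_trivIset Pp.
rewrite VT -finset.setI_eq0 finset.setIT => W0.
by have := finset.partition_neq0 Pp WP; rewrite W0.
Qed.

End BNC.

Lemma enum_val_setT n (e : #|[set: 'I_n]%SET| = n) j :
  enum_val j = cast_ord e j.
Proof.
apply: val_inj; rewrite (enum_val_nth (cast_ord e j)) enum_setT -enumT /=.
by rewrite nth_enum_ord // -[X in (_ < X)%N]e.
Qed.

Section Cumulants.
Context {C : numClosedFieldType} {A : starAlgType C} (phi : A -> C).

(* enum_val lists V in increasing order. *)
Definition restr (T : Type) (n : nat) (V : {set 'I_n}) (f : 'I_n -> T) :
  'I_#|V| -> T := fun j => f (enum_val j).
Arguments restr {T n} V f.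

(* The moment-cumulant formula solved for the term of the one-block partition;
   the first argument bounds the recursion, blocks of the other partitions
   being of size < n. See moment_cumulant. *)
Fixpoint kappa_rec (N n : nat) (chi : 'I_n -> side) (a : 'I_n -> A) : C :=
  phi (\prod_(i < n) a i) -
  (if N is N'.+1 then
     \sum_(P in BNC chi | P != [set [set: 'I_n]]%SET)
       \prod_(V in P) kappa_rec N' (restr V chi) (restr V a)
   else 0).

Definition kappa n chi a := @kappa_rec n n chi a.

Lemma kappa_rec_fuel N M n (chi : 'I_n -> side) (a : 'I_n -> A) :
  (0 < n <= N)%N -> (n <= M)%N -> kappa_rec N chi a = kappa_rec M chi a.
Proof.
elim: N M n chi a => [|N IH] [|M] n chi a /andP[n0].
- by rewrite leqNgt n0.
- by rewrite leqNgt n0.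
- by move=> _; rewrite leqNgt n0.
move=> nN nM /=; congr (_ - _).
apply: eq_bigr => P /andP[/BNC_partition Pp PT]; apply: eq_bigr => V VP.
have /andP[V0 Vn] := partition_block_lt Pp PT VP.
by apply: IH; rewrite ?V0 -ltnS; exact: leq_trans Vn _.
Qed.

Lemma kappa_setT n (chi : 'I_n -> side) (a : 'I_n -> A) :
  kappa (restr [set: 'I_n]%SET chi) (restr [set: 'I_n]%SET a) = kappa chi a.
Proof.
have e : #|[set: 'I_n]%SET| = n by rewrite cardsT card_ord.
have -> : restr [set: 'I_n]%SET chi = chi \o cast_ord e.
  by apply: funext => j; rewrite /restr /= enum_val_setT.
have -> : restr [set: 'I_n]%SET a = a \o cast_ord e.
  by apply: funext => j; rewrite /restr /= enum_val_setT.
move: (#|_|) e => m e; case: _ / e chi a => chi a.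
by congr kappa; apply: funext => i /=; rewrite cast_ord_id.
Qed.

Lemma moment_cumulant n (chi : 'I_n -> side) (a : 'I_n -> A) : (0 < n)%N ->
  phi (\prod_(i < n) a i) =
  \sum_(P in BNC chi) \prod_(V in P) kappa (restr V chi) (restr V a).
Proof.
case: n chi a => // n chi a _.
rewrite (bigD1 _ (BNC_setT chi isT)) /= big_set1 kappa_setT /kappa /=.
apply/eqP; rewrite -subr_eq; apply/eqP; congr (_ - _).
apply: eq_bigr => P /andP[/BNC_partition Pp PT]; apply: eq_bigr => V VP.
have /andP[V0 Vn] := partition_block_lt Pp PT VP.
by apply: kappa_rec_fuel; rewrite ?V0 ?leqnn.
Qed.

End Cumulants.

Section RDiagonal.
Context {C : numClosedFieldType} {A : starAlgType C}.

(* Exponents in {1, *} are booleans: true stands for *. *)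
Definition spow (x : A) (e : bool) : A := if e then star x else x.

(* chi and e encode the formal letters z_i (X or Y according to chi i, with
   exponent e i). The shape is required of these letters, not of their values:
   if X is self-adjoint, then (X, X) and (X, X^* ) are different words. *)
Definition R_diagonal_shape (m : nat) (chi : 'I_m -> side) (e : 'I_m -> bool) :=
  ~~ odd m /\
  exists (k : nat) (w : 'I_m -> bool),
    [/\ (k <= m)%N,
        forall i j : 'I_m, j = i.+1 :> nat -> w i != w j,
        forall i : 'I_m, chi (s_chi chi i) = if (i < k)%N then lft else rgt &
        forall i : 'I_m, e (s_chi chi i) = w i].

Definition R_diagonal (phi : A -> C) (X Y : A) :=
  forall (m : nat) (chi : 'I_m -> side) (e : 'I_m -> bool),
    ~ R_diagonal_shape chi e ->
    kappa phi chi (fun i => spow (if is_lft (chi i) then X else Y) (e i)) = 0.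

Variant idx := one | two.

(* The word x^{xs_1} ... x^{xs_k1} y^{ys_1} ... y^{ys_k2} *)
Record pword := PWord { xs : seq bool; ys : seq bool }.

(* w presents an element of P_{i,j}(x,y), whose value is P_val below. *)
Definition in_P (i j : idx) (w : pword) : Prop :=
  let omega := xs w ++ ys w in
  sorted (fun a b => a != b) omega /\
  match i, j with
  | one, one => odd (size omega) /\ head false omega = true
  | two, two => odd (size omega) /\ head false omega = false
  | one, two =>
      [/\ ~~ odd (size omega), (2 <= size omega)%N & head false omega = true]
  | two, one =>
      [/\ ~~ odd (size omega), (2 <= size omega)%N & head false omega = false]
  end.

Definition word_val (x y : A) (w : pword) : A :=
  (\prod_(e <- xs w) spow x e) * (\prod_(e <- ys w) spow y e).

Definition P_val (phi : A -> C) (x y : A) (i j : idx) (w : pword) : A :=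
  let z := word_val x y w in
  match i, j with
  | one, one | two, two => z
  | _, _ => z - (phi z)%:A
  end.

Definition only_x (w : pword) := ys w = [::].
Definition only_y (w : pword) := xs w = [::].
Definition both_xy (w : pword) := xs w <> [::] /\ ys w <> [::].

End RDiagonal.

(* Main.v *)
(* In the standard representation a product of the letters L(x^{+-1}), R(y^{+-1})
   has the moment phi(x...x y...y) of the word read in the order s_chi, so the
   cumulants in question are free cumulants of words x...x y...y, indexed by
   noncrossing partitions in that order. Cut such a word into its maximal
   alternating segments, where a segment of even length is centred: these are
   exactly the products in the theorem. Expanding the product and the moments, its
   value is the sum of the cumulant products over the noncrossing partitions none
   of whose unions of blocks is an even segment.

   Suppose that the cumulants of smaller order vanish off the even alternating
   words. A surviving partition other than the one-block one has only even
   alternating blocks. A word is given at place i by the parity of i + (index of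
   the segment of i), up to a global constant; between consecutive elements a < b
   of a block the gap has even length, so the segments of a and b have indices of
   the same parity, and if they differ, the gap contains a whole segment.
   Descending into gaps yields a segment which is a union of blocks, hence even: a
   contradiction. So the centred product equals the top cumulant, unless the word
   is itself even and alternating. *)
From HB Require Import structures.
Require Import Defs.
From mathcomp Require Import all_boot all_order all_algebra complex.
From mathcomp Require Import boolp classical_sets reals topology normedtype.
From mathcomp Require Import fintype finset perm zify.

Set Implicit Arguments.
Unset Strict Implicit.
Unset Printing Implicit Defensive.

Import GRing.Theory.
Local Open Scope ring_scope.

(** * Noncrossing partitions of a subset, and unions of blocks *)

Definition NCset n (E : {set 'I_n}) (P : {set {set 'I_n}}) : bool :=
  partition P E && noncrossing P.

(** If [P] covers [B], this says that [B] is a union of blocks of [P]. *)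
Definition saturated (T : finType) (P : {set {set T}}) (B : {set T}) : bool :=
  [forall V in P, (V \subset B) || [disjoint V & B]].

Lemma saturatedP (T : finType) (P : {set {set T}}) (B : {set T}) :
  reflect {in P, forall V : {set T}, V \subset B \/ [disjoint V & B]}
          (saturated P B).
Proof.
apply: (iffP 'forall_implyP) => h V /h; first by move/orP.
by move=> ?; apply/orP.
Qed.

Lemma partition_alt (T : finType) (P : {set {set T}}) (E : {set T}) :
  partition P E <->
  [/\ {in P, forall V : {set T}, V \subset E},
      {in P &, forall V W : {set T}, V != W -> [disjoint V & W]},
      {in P, forall V : {set T}, V != set0} &
      {in E, forall i, exists2 V, V \in P & i \in V}].
Proof.
split=> [Pp|[sub triv ne cov]].
  split=> [V VP|V W VP WP VW|V VP|i iE].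
  - exact: partitionS Pp VP.
  - exact: (trivIsetP (partition_trivIset Pp)).
  - exact: partition_neq0 Pp VP.
  - have : i \in cover P by rewrite (cover_partition Pp).
    by case/bigcupP => V VP iV; exists V.
apply/and3P; split.
- apply/eqP/setP => i; apply/bigcupP/idP => [[V VP iV]|iE].
    exact: (subsetP (sub _ VP)).
  by have [V VP iV] := cov _ iE; exists V.
- by apply/trivIsetP => V W VP WP; exact: triv.
- by apply/negP => /ne; rewrite eqxx.
Qed.

Lemma noncrossingP n (P : {set {set 'I_n}}) :
  reflect (forall V W, V \in P -> W \in P -> V != W ->
             forall a b c d : 'I_n, (a < b < c)%N -> (c < d)%N ->
             a \in V -> c \in V -> b \in W -> d \in W -> False)
          (noncrossing P).
Proof.
apply: (iffP idP) => [nc V W VP WP VW a b c d /andP[ab bc] cd aV cV bW dW|nc].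
  move/forall_inP/(_ _ VP)/forall_inP/(_ _ WP)/implyP/(_ VW)/negP: nc; apply.
  apply/existsP; exists a; apply/existsP; exists b.
  by apply/existsP; exists c; apply/existsP; exists d; rewrite ab bc cd aV cV bW.
apply/forall_inP => V VP; apply/forall_inP => W WP; apply/implyP => VW.
apply/negP => /existsP[a /existsP[b /existsP[c /existsP[d]]]].
case/and5P => ab bc cd aV /and3P[cV bW dW].
by apply: (nc V W VP WP VW a b c d) => //; rewrite ab.
Qed.

(** * Splitting noncrossing partitions along a convex set *)

Section Split.
Context {C : comNzRingType} {n : nat}.
Variables (f : {set 'I_n} -> C) (E B : {set 'I_n}).
Hypothesis BE : B \subset E.
Hypothesis Bconv : forall a b c : 'I_n, (a < b < c)%N ->
  a \in B -> c \in B -> b \in B.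

Let inside (P : {set {set 'I_n}}) := [set V in P | V \subset B].
Let outside (P : {set {set 'I_n}}) := [set V in P | ~~ (V \subset B)].

(** A crossing of a block inside [B] with a block outside it would put a point of the latter between
    two points of the former, against the convexity of [B]. *)
Lemma NCset_setU P1 P2 :
  NCset B P1 -> NCset (E :\: B) P2 -> NCset E (P1 :|: P2).
Proof.
case/andP => /partition_alt[s1 t1 n1 c1] /noncrossingP x1.
case/andP => /partition_alt[s2 t2 n2 c2] /noncrossingP x2.
have d12 V W : V \in P1 -> W \in P2 -> [disjoint V & W].
  move=> /s1 /subsetP VB /s2 /subsetP WB.
  rewrite disjoint_subset; apply/subsetP => i /VB iB; rewrite inE.
  by apply/negP => /WB; rewrite inE iB.
apply/andP; split.
  apply/partition_alt; split.
  - move=> V; rewrite inE => /orP[/s1 VB|/s2 VB]; first exact: subset_trans BE.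
    by apply: (subset_trans VB); exact: subsetDl.
  - move=> V W; rewrite !inE => /orP[VP|VP] /orP[WP|WP] VW.
    + exact: t1.
    + exact: d12.
    + by rewrite disjoint_sym d12.
    + exact: t2.
  - by move=> V; rewrite inE => /orP[/n1|/n2].
  - move=> i iE; have [iB|iB] := boolP (i \in B).
      by have [V VP iV] := c1 _ iB; exists V; rewrite // inE VP.
    have [|V VP iV] := c2 i; first by rewrite inE iB.
    by exists V; rewrite // inE VP orbT.
apply/noncrossingP => V W; rewrite !inE => VP WP VW a b c d abc cd aV cV bW dW.
case/orP: VP => VP; case/orP: WP => WP.
- exact: (x1 V W VP WP VW a b c d).
- have := subsetP (s2 _ WP) _ bW; rewrite inE.
  by rewrite (Bconv abc) // (subsetP (s1 _ VP)).
- have := subsetP (s2 _ VP) _ cV; rewrite inE (@Bconv b c d) //.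
  + by case/andP: abc => _ ->.
  + exact: (subsetP (s1 _ WP)).
  + exact: (subsetP (s1 _ WP)).
- exact: (x2 V W VP WP VW a b c d).
Qed.

Lemma NCset_inside P : NCset E P -> saturated P B ->
  NCset B (inside P) /\ NCset (E :\: B) (outside P).
Proof.
case/andP => /partition_alt[s t ne c] /noncrossingP x /saturatedP sat.
split; apply/andP; split.
- apply/partition_alt; split.
  + by move=> V; rewrite inE => /andP[].
  + by move=> V W; rewrite !inE => /andP[VP _] /andP[WP _]; exact: t.
  + by move=> V; rewrite inE => /andP[/ne].
  + move=> i iB; have [V VP iV] := c _ (subsetP BE _ iB).
    exists V => //; rewrite inE VP /=.
    by case: (sat _ VP) => // /disjointFr/(_ iV); rewrite iB.
- apply/noncrossingP => V W; rewrite !inE => /andP[VP _] /andP[WP _].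
  exact: x.
- apply/partition_alt; split.
  + move=> V; rewrite inE => /andP[VP VB].
    case: (sat _ VP) => [VB'|dV]; first by rewrite VB' in VB.
    by rewrite subsetD s.
  + by move=> V W; rewrite !inE => /andP[VP _] /andP[WP _]; exact: t.
  + by move=> V; rewrite inE => /andP[/ne].
  + move=> i; rewrite inE => /andP[iB iE]; have [V VP iV] := c _ iE.
    exists V => //; rewrite inE VP /=.
    by apply/negP => /subsetP/(_ _ iV); rewrite (negPf iB).
- apply/noncrossingP => V W; rewrite !inE => /andP[VP _] /andP[WP _].
  exact: x.
Qed.

(** A partition with [B] saturated amounts to the pair formed by its blocks inside [B] and its
    remaining blocks. The side condition [Q] is one that only sees the remaining blocks, so the sum
    factors. *)
Lemma sum_NCset_saturated (Q : pred {set {set 'I_n}}) :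
  (forall P1 P2, NCset B P1 -> NCset (E :\: B) P2 -> Q (P1 :|: P2) = Q P2) ->
  \sum_(P | [&& NCset E P, saturated P B & Q P]) \prod_(V in P) f V =
  (\sum_(P | NCset B P) \prod_(V in P) f V) *
  (\sum_(P | NCset (E :\: B) P && Q P) \prod_(V in P) f V).
Proof.
move=> QU; rewrite big_distrlr /= pair_big /=.
rewrite (reindex_onto (fun p => p.1 :|: p.2) (fun P => (inside P, outside P))) /=.
  have ins P1 P2 : NCset B P1 -> NCset (E :\: B) P2 ->
      inside (P1 :|: P2) = P1 /\ outside (P1 :|: P2) = P2.
    case/andP => /partition_alt[s1 _ _ _] _.
    case/andP => /partition_alt[s2 _ n2 _] _.
    have P2B V : V \in P2 -> ~~ (V \subset B).
      move=> VP; have /set0Pn[i iV] := n2 _ VP.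
      apply/negP => /subsetP/(_ _ iV) iB.
      by have := subsetP (s2 _ VP) _ iV; rewrite inE iB.
    split; apply/setP => V; rewrite !inE.
      apply/andP/idP => [[/orP[//|/P2B/negPf -> //]]|VP].
      by rewrite VP s1.
    apply/andP/idP => [[/orP[VP|//]]|VP]; first by rewrite s1.
    by rewrite VP orbT P2B.
  apply: eq_big => [[P1 P2] /=|[P1 P2] /=].
    apply/idP/idP.
      case/andP => /and3P[nE sat qP] /eqP[i1 i2].
      have [] := NCset_inside nE sat; rewrite i1 i2 => n1 n2.
      by rewrite n1 n2 /= -(QU P1).
    case/and3P => n1 n2 q2; have [-> ->] := ins _ _ n1 n2.
    rewrite eqxx andbT NCset_setU // QU // q2 andbT.
    case/andP: n1 => /partition_alt[s1 _ _ _] _.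
    case/andP: n2 => /partition_alt[s2 _ _ _] _.
    apply/saturatedP => V; rewrite inE => /orP[/s1|/s2]; first by left.
    by rewrite subsetD => /andP[_]; right.
  case/andP => /and3P[nE sat qP] /eqP[i1 i2].
  have d12 : [disjoint P1 & P2].
    rewrite disjoint_subset; apply/subsetP => V VP1; rewrite inE.
    apply/negP; move: VP1; rewrite -{1}i1 -{2}i2 !inE.
    by move=> /andP[_ ->]; rewrite andbF.
  rewrite -(@bigU _ _ _ _ (mem P1) (mem P2)) //.
  by apply: eq_bigl => V; rewrite !inE.
move=> P _; apply/setP => V; rewrite !inE -andb_orr orbN andbT //.
Qed.

End Split.

(** * Gaps between consecutive elements of a block *)

Lemma card_ord_interval n (l u : nat) : (u <= n)%N ->
  #|[set i : 'I_n | (l <= i < u)%N]| = (u - l)%N.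
Proof.
move=> un; rewrite -sum1_card -[RHS]muln1 -sum_nat_const_nat.
rewrite (big_nat_widen _ _ _ _ _ un) big_geq_mkord /=.
by apply: eq_bigl => i; rewrite inE andbC.
Qed.

(** [B] is the disjoint union of the blocks contained in it, each of even size. *)
Lemma even_card_saturated (T : finType) (P : {set {set T}}) (B : {set T}) :
  partition P [set: T] -> saturated P B ->
  {in P, forall V : {set T}, ~~ odd #|V|} -> ~~ odd #|B|.
Proof.
move=> /partition_alt[_ t ne c] /saturatedP sat ev.
have /card_partition -> : partition [set V in P | V \subset B] B.
  apply/partition_alt; split.
  - by move=> V; rewrite inE => /andP[].
  - by move=> V W; rewrite !inE => /andP[VP _] /andP[WP _]; exact: t.
  - by move=> V; rewrite inE => /andP[/ne].
  - move=> i iB; have [V VP iV] := c i (in_setT _).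
    exists V => //; rewrite inE VP /=.
    by case: (sat _ VP) => // /disjointFr/(_ iV); rewrite iB.
apply: (big_ind (fun k => ~~ odd k)) => // [k m|V]; rewrite ?oddD ?inE.
  by move=> /negPf -> /negPf ->.
by case/andP => /ev.
Qed.

Section GapArgument.
Context {n : nat}.
Variables (P : {set {set 'I_n}}) (sg : 'I_n -> nat).
Hypothesis ncP : NCset [set: 'I_n] P.
Hypothesis evP : {in P, forall V : {set 'I_n}, ~~ odd #|V|}.
Hypothesis sg_mono : {homo sg : i j / (i <= j)%N >-> (i <= j)%N}.
Hypothesis sg_onto : forall (a b : 'I_n) j, (sg a <= j <= sg b)%N ->
  exists c, sg c = j.

Definition consecutive (V : {set 'I_n}) (a b : 'I_n) :=
  [/\ a \in V, b \in V, (a < b)%N & forall c, c \in V -> ~~ (a < c < b)%N].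

(** A block with one point in the gap and another outside it would cross [V]: the outside point
    differs from [a] and [b], so it lies beyond one of them. *)
Lemma gap_saturated V a b : V \in P -> consecutive V a b ->
  saturated P [set i : 'I_n | (a < i < b)%N].
Proof.
move=> VP [aV bV ab gap]; apply/saturatedP => W WP.
case/andP: ncP => /partition_alt[_ t _ _] /noncrossingP x.
have [<-|VW] := eqVneq V W.
  right; rewrite disjoint_subset; apply/subsetP => i /gap.
  by rewrite !inE.
have dVW := t _ _ VP WP VW.
have [sub|/subsetPn[d dW dgap]] :=
  boolP (W \subset [set i : 'I_n | (a < i < b)%N]); first by left.
right; rewrite disjoint_subset; apply/subsetP => c cW; rewrite !inE.
apply/negP => /andP[ac cb].
have da : d != a by apply: contraTneq dW => ->; rewrite (disjointFr dVW).
have db : d != b by apply: contraTneq dW => ->; rewrite (disjointFr dVW).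
have [da'|ad] := ltnP d a.
  by apply: (x W V WP VP _ d a c b); rewrite 1?eq_sym ?da' ?ac.
have [bd|db'] := ltnP b d.
  by apply: (x V W VP WP VW a c b d); rewrite ?ac.
move: dgap; rewrite inE; move: da db ad db'.
by rewrite -!val_eqE /=; clear; lia.
Qed.

(** Induction on b - a: an element of [V] in between leaves a jump of [sg] on at least one of its
    two sides. *)
Lemma consecutive_jump (V : {set 'I_n}) a b : a \in V -> b \in V -> (sg a < sg b)%N ->
  exists a' b', consecutive V a' b' /\ (sg a' < sg b')%N.
Proof.
move: {2}(b - a)%N (leqnn (b - a)) => m.
elim: m a b => [|m IH] a b bam aV bV sab.
  have /sg_mono : (b <= a)%N by lia.
  by rewrite leqNgt sab.
have ab : (a < b)%N.
  by rewrite ltnNge; apply/negP => /sg_mono; rewrite leqNgt sab.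
have [/existsP[c /andP[cV /andP[ac cb]]]|/existsPn gap] :=
  boolP [exists c, (c \in V) && (a < c < b)%N].
  have [sac|sca] := ltnP (sg a) (sg c).
    by apply: (IH a c) => //; lia.
  by apply: (IH c b) => //; [lia | exact: leq_ltn_trans sca sab].
exists a, b; split=> //; split=> // c cV.
by have := gap c; rewrite cV.
Qed.

Hypothesis sg_parity : {in P, forall (V : {set 'I_n}) a b,
  consecutive V a b -> odd (a + sg a) != odd (b + sg b)}.

(** Descent on saturated intervals [l, u) containing the whole segment of some [c0]. If this segment
    is not saturated, a block meets it without lying in it; this block stays in [l, u) and has
    consecutive elements in different segments. Their gap is the next, smaller interval. *)
Lemma exists_saturated (i0 : 'I_n) :
  exists c, saturated P [set i | sg i == sg c].
Proof.
suff H m : forall (l u : nat) (c0 : 'I_n), (u - l <= m)%N ->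
    saturated P [set i : 'I_n | (l <= i < u)%N] ->
    (forall i, sg i = sg c0 -> (l <= i < u)%N) ->
    exists c, saturated P [set i | sg i == sg c].
  apply: (H n 0%N n i0); first by rewrite subn0.
    by apply/saturatedP => V _; left; apply/subsetP => i _; rewrite inE /=.
  by move=> i _ /=.
elim: m => [|m IH] l u c0 ulm satI inI; first by have := inI c0 erefl; lia.
have [sat0|nsat] := boolP (saturated P [set i | sg i == sg c0]); first by exists c0.
move: nsat; rewrite negb_forall_in => /exists_inP[V VP].
rewrite negb_or => /andP[/subsetPn[k kV]]; rewrite inE => sk.
rewrite -setI_eq0 => /set0Pn[i']; rewrite !inE => /andP[iV /eqP si].
have VI : V \subset [set i : 'I_n | (l <= i < u)%N].
  case: (saturatedP _ _ satI _ VP) => // /disjointFr/(_ iV).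
  by rewrite inE inI.
have [a [b [[aV bV ab gap] sab]]] :
    exists a b, consecutive V a b /\ (sg a < sg b)%N.
  have [ski|sik|/eqP] := ltngtP (sg k) (sg i').
  - exact: consecutive_jump ski.
  - exact: consecutive_jump sik.
  - by rewrite si (negPf sk).
have cons : consecutive V a b by [].
have satG := gap_saturated VP cons.
have evG : ~~ odd (b - a.+1).
  rewrite -(@card_ord_interval n) ?(ltnW (ltn_ord b)) //.
  by case/andP: ncP => Pp _; apply: even_card_saturated Pp _ evP.
have par := sg_parity VP cons.
(* Since b - a is odd, [sg a] and [sg b] have the same parity. Being distinct they differ by at
   least 2, so the segment of index [(sg a).+1] lies entirely in the gap. *)
have sab2 : ((sg a).+1 < sg b)%N.
  rewrite ltn_neqAle sab andbT; apply: contra par => /eqP <-.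
  by move: evG; rewrite oddB // !oddD /=; do 3!case: odd.
have [c1 sc1] : exists c, sg c = (sg a).+1.
  by apply: (@sg_onto a b); rewrite leqnSn ltnW.
apply: (IH a.+1 b c1) => //.
  have := subsetP VI _ aV; have := subsetP VI _ bV; rewrite !inE.
  by move: ulm ab; clear; lia.
move=> j; rewrite sc1 => sj; apply/andP; split.
  by rewrite ltnNge; apply/negP => /sg_mono; rewrite sj ltnn.
by rewrite ltnNge; apply/negP => /sg_mono; rewrite sj leqNgt sab2.
Qed.

End GapArgument.

(** * Expansion of a product with some centred segments *)

Section CenteredProduct.
Context {C : comNzRingType} {A : algType C} (phi : A -> C).
Hypothesis phi_scalar : scalar phi.
Variables (n r : nat) (c sg : nat -> nat) (a : nat -> A) (f : {set 'I_n} -> C).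
Hypotheses (c0 : c 0 = 0%N) (cr : c r = n).
Hypothesis c_mono : {homo c : i j / (i <= j)%N >-> (i <= j)%N}.
Hypothesis sgE : forall i j, (j < r)%N -> (c j <= i < c j.+1)%N -> sg i = j.
Hypothesis sg_mono : {homo sg : i j / (i <= j)%N >-> (i <= j)%N}.
Hypothesis moment : forall E : {set 'I_n},
  phi (\prod_(i < n | i \in E) a i) = \sum_(P | NCset E P) \prod_(V in P) f V.

Definition segments (D : pred nat) : {set 'I_n} := [set i : 'I_n | D (sg i)].
Definition seg_prod j : A := \prod_(c j <= i < c j.+1) a i.

Lemma prod_segments (D : pred nat) :
  \prod_(i < n | i \in segments D) a i = \prod_(0 <= j < r | D j) seg_prod j.
Proof.
transitivity (\prod_(0 <= i < n | D (sg i)) a i).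
  by rewrite big_mkord; apply: eq_bigl => i; rewrite inE.
rewrite -cr; suff H k : (k <= r)%N -> \prod_(0 <= i < c k | D (sg i)) a i =
    \prod_(0 <= j < k | D j) seg_prod j by exact: H.
elim: k => [|k IH] kr.
  by rewrite c0 !big_geq.
rewrite (big_cat_nat (n := c k)) ?c_mono //= IH 1?ltnW //.
rewrite [RHS](big_cat_nat (n := k)) //=; congr (_ * _).
rewrite [RHS]big_ltn_cond //; case: ifP => Dk.
  rewrite [X in _ * X]big_geq // mulr1 /seg_prod.
  rewrite big_mkcond /=; apply: eq_big_nat => i /sgE -> //.
  by rewrite Dk.
rewrite [RHS]big_geq // big_mkcond /= big_nat; apply: big1 => i /sgE -> //.
by rewrite Dk.
Qed.

(** The product is noncommutative, so it is split around [j0]; the scalar part of that factor is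
    then moved out. *)
Lemma prod_center_factor (D : pred nat) (F : nat -> A) (z : C) j0 :
  (j0 < r)%N -> D j0 ->
  \prod_(0 <= j < r | D j) (if j == j0 then F j - z%:A else F j) =
  \prod_(0 <= j < r | D j) F j -
  z *: \prod_(0 <= j < r | D j && (j != j0)) F j.
Proof.
move=> j0r Dj0.
have split3 (G : nat -> A) (D' : pred nat) :
    \prod_(0 <= j < r | D' j) G j = \prod_(0 <= j < j0 | D' j) G j *
      ((if D' j0 then G j0 else 1) * \prod_(j0.+1 <= j < r | D' j) G j).
  rewrite (big_cat_nat (n := j0)) ?(ltnW j0r) //=; congr (_ * _).
  by rewrite big_ltn_cond //; case: (D' j0); rewrite ?mul1r.
rewrite !split3 Dj0 eqxx /= mul1r.
have pre : \prod_(0 <= j < j0 | D j) (if j == j0 then F j - z%:A else F j) =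
           \prod_(0 <= j < j0 | D j) F j.
  rewrite big_nat_cond [RHS]big_nat_cond; apply: eq_bigr => j /andP[jj _].
  by rewrite ltn_eqF.
have post : \prod_(j0.+1 <= j < r | D j) (if j == j0 then F j - z%:A else F j) =
            \prod_(j0.+1 <= j < r | D j) F j.
  rewrite big_nat_cond [RHS]big_nat_cond; apply: eq_bigr => j /andP[jj _].
  by rewrite gtn_eqF //; case/andP: jj.
have pre' : \prod_(0 <= j < j0 | D j && (j != j0)) F j =
            \prod_(0 <= j < j0 | D j) F j.
  rewrite big_nat_cond [RHS]big_nat_cond; apply: eq_bigl => j.
  by case: (ltngtP j j0) => //=; rewrite ?andbT ?andbF.
have post' : \prod_(j0.+1 <= j < r | D j && (j != j0)) F j =
            \prod_(j0.+1 <= j < r | D j) F j.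
  rewrite big_nat_cond [RHS]big_nat_cond; apply: eq_bigl => j.
  by case: (ltngtP j j0) => //=; rewrite ?andbT ?andbF.
rewrite pre post pre' post' mulrBl mulrBr -scalerAl mul1r -scalerAr //.
Qed.

(** Induction on the list [l] of centred segments. Centring at [j0] subtracts the moment of that
    segment times the value of the product without it; by [sum_NCset_saturated] this is the part of
    the sum where the segment [j0] is saturated. *)
Lemma phi_centered_prod (l : seq nat) (D : pred nat) :
  uniq l -> all (fun j => (j < r)%N && D j) l ->
  phi (\prod_(0 <= j < r | D j)
         if j \in l then seg_prod j - (phi (seg_prod j))%:A else seg_prod j) =
  \sum_(P | NCset (segments D) P &&
            all (fun j => ~~ saturated P (segments (pred1 j))) l)
    \prod_(V in P) f V.
Proof.
elim: l D => [|j0 l IH] D.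
  move=> _ _; transitivity (phi (\prod_(0 <= j < r | D j) seg_prod j)).
    by congr phi; apply: eq_bigr.
  by rewrite -prod_segments moment; apply: eq_bigl => P; rewrite andbT.
rewrite /= => /andP[j0l ul] /andP[/andP[j0r Dj0] Dl].
pose F j := if j \in l then seg_prod j - (phi (seg_prod j))%:A else seg_prod j.
rewrite [X in phi X](_ : _ = \prod_(0 <= j < r | D j)
  (if j == j0 then F j - (phi (seg_prod j0))%:A else F j)); last first.
  apply: eq_bigr => j _; rewrite inE /F; case: eqP => [->|] //=.
  by rewrite (negPf j0l).
rewrite prod_center_factor // addrC -scaleNr phi_scalar mulNr.
have /= IH2 := IH [pred j | D j && (j != j0)] ul.
rewrite /F (IH D) // IH2; last first.
  apply/allP => j jl /=; have /andP[-> ->] := allP Dl _ jl.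
  by apply: contraNneq j0l => <-.
have -> : phi (seg_prod j0) =
          \sum_(P | NCset (segments (pred1 j0)) P) \prod_(V in P) f V.
  by rewrite -moment prod_segments /= big_nat1_eq j0r.
have -> : segments [pred j | D j && (j != j0)] =
          segments D :\: segments (pred1 j0).
  by apply/setP => i; rewrite !inE andbC.
rewrite -sum_NCset_saturated.
(* The part of the full sum with [j0] saturated cancels the subtracted product. *)
- rewrite [in X in _ + X](bigID (fun P => saturated P (segments (pred1 j0)))) /=.
  rewrite addrA [X in X + _](_ : _ = 0) ?add0r.
    by apply: eq_bigl => P; rewrite -andbA; congr (_ && _); rewrite andbC.
  rewrite addrC; apply/eqP; rewrite subr_eq0; apply/eqP.
  by apply: eq_bigl => P; rewrite -andbA; congr (_ && _); rewrite andbC.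
- by apply/subsetP => i; rewrite !inE => /eqP ->.
- move=> x y z /andP[/ltnW xy /ltnW yz]; rewrite !inE => /eqP sx /eqP sz.
  by have := sg_mono xy; have := sg_mono yz; rewrite eqn_leq sx sz => -> ->.
(* Blocks inside the segment [j0] are disjoint from every other segment, so they do not affect
   whether that one is saturated. *)
- move=> P1 P2 n1 n2; apply: eq_in_all => j jl; congr (~~ _).
  have jj0 : j != j0 by apply: contraNneq j0l => <-.
  apply/saturatedP/saturatedP => sat V VP.
    by apply: sat; rewrite inE VP orbT.
  move: VP; rewrite inE => /orP[VP|]; last exact: sat.
  right; case/andP: n1 => /partition_alt[s1 _ _ _] _.
  rewrite disjoint_subset; apply/subsetP => i /(subsetP (s1 _ VP)).
  by rewrite !inE => /eqP ->; rewrite eq_sym.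
Qed.

End CenteredProduct.

(** * The index of the segment containing a given place *)

Section SegmentIndex.
Variables (n r : nat) (c : nat -> nat).
Hypotheses (c0 : c 0 = 0%N) (cr : c r = n).
Hypothesis c_mono : {homo c : i j / (i <= j)%N >-> (i <= j)%N}.
Hypothesis c_lt : forall j, (j < r)%N -> (c j < c j.+1)%N.

(** Counts the segments ending at or before [i]; in this form it is defined for all [i] and visibly
    monotone. *)
Definition seg_index i := (\sum_(0 <= j < r) (c j.+1 <= i))%N.

Lemma seg_index_mono : {homo seg_index : i j / (i <= j)%N >-> (i <= j)%N}.
Proof.
move=> i j ij; apply: leq_sum => k _.
by case: (leqP _ i) => // /leq_trans/(_ ij) ->.
Qed.

Lemma seg_indexE i j : (j < r)%N -> (c j <= i < c j.+1)%N -> seg_index i = j.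
Proof.
move=> jr /andP[ji ij]; rewrite /seg_index (big_cat_nat (n := j)) ?(ltnW jr) //=.
rewrite [X in (X + _)%N](_ : _ = j); last first.
  rewrite -[RHS]muln1 -[X in (X * _)%N]subn0 -sum_nat_const_nat.
  apply: eq_big_nat => k /andP[_ kj].
  by rewrite (leq_trans (c_mono kj) ji).
rewrite big_nat big1 ?addn0 // => k /andP[jk _].
by rewrite leqNgt (leq_trans ij) // c_mono.
Qed.

Lemma segment_cover i : (i < n)%N ->
  exists2 j, (j < r)%N & (c j <= i < c j.+1)%N.
Proof.
rewrite -cr; elim: r => [|k IH]; first by rewrite c0.
have [ick|cki] := ltnP i (c k); last by exists k => //; rewrite cki.
by have [j jk h] := IH ick; exists j => //; rewrite ltnW.
Qed.

Lemma seg_index_eq i j : (i < n)%N -> (j < r)%N ->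
  (seg_index i == j) = (c j <= i < c j.+1)%N.
Proof.
move=> iin jr; apply/eqP/idP => [<-|]; last exact: seg_indexE.
by have [k kr h] := segment_cover iin; rewrite (seg_indexE kr h).
Qed.

Lemma seg_index_lt i : (i < n)%N -> (seg_index i < r)%N.
Proof. by move=> /segment_cover[k kr h]; rewrite (seg_indexE kr h). Qed.

Lemma segment_lt j : (j < r)%N -> (c j < n)%N.
Proof. by move=> jr; rewrite -cr (leq_trans (c_lt jr)) // c_mono. Qed.

Lemma seg_index_start j : (j < r)%N -> seg_index (c j) = j.
Proof. by move=> jr; apply: seg_indexE => //; rewrite leqnn c_lt. Qed.

End SegmentIndex.

(** * The centred product equals the top cumulant *)

Section TopCumulant.
Context {C : comNzRingType} {A : algType C} (phi : A -> C).
Hypothesis phi_scalar : scalar phi.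
Variables (n r : nat) (c : nat -> nat) (a : nat -> A) (f : {set 'I_n} -> C).
Hypotheses (c0 : c 0 = 0%N) (cr : c r = n).
Hypothesis c_mono : {homo c : i j / (i <= j)%N >-> (i <= j)%N}.
Hypothesis c_lt : forall j, (j < r)%N -> (c j < c j.+1)%N.
Hypothesis moment : forall E : {set 'I_n},
  phi (\prod_(i < n | i \in E) a i) = \sum_(P | NCset E P) \prod_(V in P) f V.
Variables (w : 'I_n -> bool) (s0 : bool).
Hypothesis wE : forall i : 'I_n, w i = s0 (+) odd (i + seg_index r c i).
Hypothesis f_vanish : forall V : {set 'I_n}, V != [set: 'I_n] -> f V != 0 ->
  ~~ odd #|V| /\ forall i j, consecutive V i j -> w i != w j.
Hypothesis r_gt0 : (0 < r)%N.
Hypothesis not_single : ~~ ((r == 1%N) && ~~ odd n).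

Let sg := seg_index r c.
Let center j :=
  if odd (c j.+1 - c j) then seg_prod c a j
  else seg_prod c a j - (phi (seg_prod c a j))%:A.

Let card_segment j : (j < r)%N ->
  #|segments n sg (pred1 j)| = (c j.+1 - c j)%N.
Proof.
move=> jr; rewrite -(@card_ord_interval n); last by rewrite -cr c_mono.
by apply: eq_card => i; rewrite !inE /= (seg_index_eq c0 cr).
Qed.

Let NCsetT : NCset [set: 'I_n] [set [set: 'I_n]].
Proof.
apply/andP; split.
  apply/partition_alt; split.
  - by move=> V _; apply/subsetP => i _; rewrite inE.
  - by move=> V W; rewrite !inE => /eqP -> /eqP ->; rewrite eqxx.
  - move=> V; rewrite inE => /eqP ->; apply/set0Pn.
    by exists (Ordinal (segment_lt cr c_mono c_lt r_gt0)); rewrite inE.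
  - by move=> i _; exists [set: 'I_n]; rewrite !inE.
by apply/noncrossingP => V W; rewrite !inE => /eqP -> /eqP -> /eqP[].
Qed.

(** [phi_centered_prod] gives a sum over the partitions in which no even segment is saturated. The
    one-block partition survives, and [exists_saturated] shows that every other surviving partition
    has a block of weight 0. *)
Theorem top_cumulant : phi (\prod_(0 <= j < r) center j) = f [set: 'I_n].
Proof.
pose l := [seq j <- iota 0 r | ~~ odd (c j.+1 - c j)].
have lE j : j \in l = (j < r)%N && ~~ odd (c j.+1 - c j).
  by rewrite mem_filter mem_iota /= add0n andbC.
transitivity (phi (\prod_(0 <= j < r | xpredT j)
    if j \in l then seg_prod c a j - (phi (seg_prod c a j))%:A
    else seg_prod c a j)).
  congr phi; apply: eq_big_nat => j /andP[_ jr].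
  by rewrite lE jr /center; case: odd.
rewrite (phi_centered_prod phi_scalar c0 cr c_mono (seg_indexE c_mono)
  (@seg_index_mono r c) moment) ?filter_uniq ?iota_uniq //; last first.
  by apply/allP => j; rewrite lE andbT => /andP[].
have -> : segments n sg predT = [set: 'I_n].
  by apply/setP => i; rewrite !inE.
rewrite (bigD1 [set [set: 'I_n]]) /=; last first.
  rewrite NCsetT; apply/allP => j; rewrite lE => /andP[jr evj].
  (* If the even segment [j] were saturated, the only block would lie in it, so r = 1 and n would be
     even, which [not_single] excludes. *)
  apply/negP => /saturatedP/(_ [set: 'I_n]); rewrite inE eqxx => /(_ isT).
  have cn k kr := @segment_lt n r c cr c_mono c_lt k kr.
  case=> [sub|/disjointFr/(_ (in_setT (Ordinal (cn _ jr))))]; last first.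
    by rewrite inE /= /sg (seg_index_start c_mono c_lt) // eqxx.
  have all_j k : (k < r)%N -> k = j.
    move=> kr; have := subsetP sub (Ordinal (cn _ kr)) (in_setT _).
    by rewrite inE /= /sg (seg_index_start c_mono c_lt) // => /eqP.
  have j0 : j = 0%N by rewrite -(all_j 0%N).
  have r1 : r = 1%N.
    by apply/eqP; rewrite eqn_leq r_gt0 andbT leqNgt; apply/negP => /all_j; rewrite j0.
  by move: not_single evj; rewrite -cr r1 j0 c0 subn0 eqxx /= => /negP.
rewrite big_set1 big1 ?addr0 // => P /andP[/andP[ncP /allP nsat] PT].
(* If all weights are nonzero, every block is proper, hence even and alternating. Some segment is
   then saturated, so it has even length and belongs to [l], a contradiction. *)
have [/exists_inP[V VP /eqP fV]|] := boolP [exists V in P, f V == 0].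
  by rewrite (bigD1 V) //= fV mul0r.
rewrite negb_exists_in => /forall_inP fne.
have [Pp _] := andP ncP.
have good V : V \in P ->
    ~~ odd #|V| /\ forall i j, consecutive V i j -> w i != w j.
  move=> VP; apply: f_vanish; last exact: fne.
  have := partition_block_lt Pp PT VP.
  by apply: contraTneq => ->; rewrite cardsT card_ord ltnn andbF.
have evP : {in P, forall V : {set 'I_n}, ~~ odd #|V|} by move=> V /good[].
have [||V VP i j||i0 sat0] := @exists_saturated n P (fun i => sg i) ncP evP.
- by move=> i j; exact: seg_index_mono.
- move=> i j k /andP[_ kj].
  have kr : (k < r)%N.
    by apply: leq_ltn_trans kj _; apply: (seg_index_lt c0 cr).
  exists (Ordinal (segment_lt cr c_mono c_lt kr)).
  by rewrite /sg /= (seg_index_start c_mono c_lt).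
- by move=> /(proj2 (good _ VP)); rewrite !wE; apply: contra => /eqP ->.
- exact: Ordinal (segment_lt cr c_mono c_lt r_gt0).
have sr : (sg i0 < r)%N by apply: (seg_index_lt c0 cr).
suff sl : sg i0 \in l by case/negP: (nsat _ sl); exact: sat0.
by rewrite lE sr -card_segment //; apply: even_card_saturated evP.
Qed.

End TopCumulant.

(** * Restricting the order [s_chi] to a subset *)

Arguments restr {T n} V f.

Lemma big_ord_enum (R : Type) (idx : R) (op : R -> R -> R) n (P : pred 'I_n)
    (F : 'I_n -> R) :
  \big[op/idx]_(i < n | P i) F i = \big[op/idx]_(i <- enum 'I_n | P i) F i.
Proof. by rewrite enumT unlock. Qed.

Lemma enum_filter (T : finType) (E : {set T}) :
  enum E = [seq i <- enum T | i \in E].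
Proof. by rewrite enumT. Qed.

Lemma map_enum_val (T : finType) (E : {set T}) :
  [seq enum_val i | i <- enum 'I_#|E|] = enum E.
Proof.
case: (set_0Vmem E) => [->|[x xE]].
  rewrite [RHS]size0nil; last by rewrite -cardE cards0.
  by apply: size0nil; rewrite size_map size_enum_ord cards0.
apply: (@eq_from_nth _ x); rewrite size_map size_enum_ord ?cardE // => i iE.
rewrite (nth_map (Ordinal iE)) ?size_enum_ord //.
rewrite (enum_val_nth x) /= nth_enum_ord //.
Qed.

Lemma enum_imset_enum_val (n : nat) (E : {set 'I_n}) (V : {set 'I_#|E|}) :
  enum [set enum_val i | i in V] = [seq enum_val i | i <- enum V].
Proof.
have -> : enum [set enum_val i | i in V] =
    [seq i <- enum E | i \in [set enum_val i | i in V]].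
  rewrite enum_filter (enum_filter E) -filter_predI; apply: eq_filter => i /=.
  by case: imsetP => // -[j jV ->]; rewrite enum_valP.
rewrite -map_enum_val filter_map (enum_filter V); congr map.
by apply: eq_filter => i /=; rewrite mem_imset //; exact: enum_val_inj.
Qed.

Lemma chi_seqE n (chi : 'I_n -> side) :
  chi_seq chi = [seq s_chi chi i | i <- enum 'I_n].
Proof.
case: n chi => [|m] chi.
  by rewrite (size0nil (size_chi_seq chi)) [RHS]size0nil // size_map size_enum_ord.
apply: (@eq_from_nth _ ord0); first by rewrite size_map size_enum_ord size_chi_seq.
rewrite size_chi_seq => i im.
rewrite (nth_map ord0) ?size_enum_ord // permE nth_enum_ord //.
by apply: set_nth_default; rewrite size_chi_seq.
Qed.

Section ChiOrder.
Variables (n : nat) (chi : 'I_n -> side).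

(** Both halves of [chi_seq] are, up to reversal, filters of the increasing enumeration, and filters
    commute. *)
Lemma chi_seq_restr (E : {set 'I_n}) :
  [seq enum_val j | j <- chi_seq (restr E chi)] = [seq i <- chi_seq chi | i \in E].
Proof.
have side_filter (p : pred side) :
    [seq enum_val j | j <- [seq j <- enum 'I_#|E| | p (restr E chi j)]] =
    [seq i <- [seq i <- enum 'I_n | p (chi i)] | i \in E].
  rewrite -(filter_map enum_val (fun i => p (chi i))) map_enum_val (enum_filter E).
  by rewrite -[LHS]filter_predI -[RHS]filter_predI; apply: eq_filter => i; exact: andbC.
rewrite /chi_seq map_cat map_rev filter_cat filter_rev.
by rewrite (side_filter is_lft) (side_filter (fun s => ~~ is_lft s)).
Qed.

Variable E : {set 'I_n}.
Let sE := [set s_chi chi i | i in E].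

(* The increasing enumeration of E, up to the equality of #|E| and #|sE|. *)
Definition chi_lift (j : 'I_#|sE|) : 'I_n :=
  (s_chi chi)^-1%g (enum_val (s_chi (restr sE chi) j)).

Lemma s_chi_lift j : s_chi chi (chi_lift j) = enum_val (s_chi (restr sE chi) j).
Proof. exact: permKV. Qed.

Lemma map_chi_lift : [seq chi_lift j | j <- enum 'I_#|sE|] = enum E.
Proof.
transitivity [seq (s_chi chi)^-1%g i
             | i <- [seq enum_val j | j <- chi_seq (restr sE chi)]].
  by rewrite chi_seqE -!map_comp.
rewrite chi_seq_restr chi_seqE filter_map -map_comp.
rewrite (eq_map (g := id)) ?map_id; last by move=> i /=; rewrite permK.
rewrite (enum_filter E); apply: eq_filter => i /=.
by rewrite mem_imset //; exact: perm_inj.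
Qed.

Let enum_sorted : sorted (fun i j : 'I_n => (i < j)%N) (enum E).
Proof.
rewrite (enum_filter E); apply: sorted_filter; first by move=> ? ? ?; exact: ltn_trans.
by have := iota_ltn_sorted 0 n; rewrite -val_enum_ord sorted_map.
Qed.

Lemma chi_lift_lt (i j : 'I_#|sE|) : (i < j)%N -> (chi_lift i < chi_lift j)%N.
Proof.
move=> ij; pose x := chi_lift i.
have nthE k : chi_lift k = nth x (enum E) k.
  by rewrite -map_chi_lift (nth_map k) ?size_enum_ord // nth_ord_enum.
have szE : size (enum E) = #|sE| by rewrite -map_chi_lift size_map size_enum_ord.
rewrite !nthE; apply: (sorted_ltn_nth _ _ enum_sorted) => //.
- by move=> ? ? ?; exact: ltn_trans.
- by rewrite inE szE.
- by rewrite inE szE.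
Qed.

Lemma mem_chi_lift i : (i \in E) = (i \in [set chi_lift j | j in [set: 'I_#|sE|]]).
Proof.
rewrite -mem_enum -map_chi_lift; apply/mapP/imsetP => -[j _ ->]; exists j => //.
by rewrite mem_enum.
Qed.

Lemma s_chi_lift_imset (V : {set 'I_#|sE|}) :
  [set s_chi chi i | i in [set chi_lift j | j in V]] =
  [set enum_val i | i in [set s_chi (restr sE chi) j | j in V]].
Proof. by rewrite -!imset_comp; apply: eq_imset => j /=; rewrite s_chi_lift. Qed.

End ChiOrder.

(** * Transport of noncrossing partitions along increasing maps *)

Section Transport.
Variables (m n : nat) (h : 'I_m -> 'I_n).
Hypothesis h_lt : forall i j : 'I_m, (i < j)%N -> (h i < h j)%N.

Let h_inj : injective h.
Proof.
move=> i j hij; apply: val_inj.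
by case: (ltngtP i j) => // /h_lt; rewrite hij ltnn.
Qed.

Let h_ltE (i j : 'I_m) : (h i < h j)%N = (i < j)%N.
Proof.
apply/idP/idP => [|/h_lt //]; apply: contraTT; rewrite -!leqNgt leq_eqVlt.
by case/orP => [/eqP/val_inj ->|/h_lt/ltnW].
Qed.

Lemma noncrossing_imset (Q : {set {set 'I_m}}) :
  noncrossing [set [set h i | i in V] | V : {set 'I_m} in Q] = noncrossing Q.
Proof.
apply/noncrossingP/noncrossingP => nc.
  move=> V W VQ WQ VW a b c d abc cd aV cV bW dW.
  apply: (nc (h @: V) (h @: W) _ _ _ (h a) (h b) (h c) (h d));
    rewrite ?h_ltE ?imset_f //.
  by apply: contraNneq VW => /(imset_inj h_inj) ->.
move=> _ _ /imsetP[V VQ ->] /imsetP[W WQ ->] VW x y z t.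
move=> xyz zt /imsetP[a aV ex] /imsetP[c cV ez] /imsetP[b bW ey] /imsetP[d dW et].
move: xyz zt; rewrite ex ey ez et !h_ltE => abc cd.
apply: (nc V W VQ WQ _ a b c d) => //.
by apply: contraNneq VW => ->.
Qed.

(** A strictly increasing [h] maps noncrossing partitions of its domain bijectively to those of its
    image; blockwise preimage is the inverse. *)
Lemma sum_NC_imset (C : comNzRingType) (F : {set 'I_n} -> C) :
  \sum_(Q in NC m) \prod_(V in Q) F [set h i | i in V] =
  \sum_(P | NCset [set h i | i in [set: 'I_m]] P) \prod_(V in P) F V.
Proof.
pose H (Q : {set {set 'I_m}}) := [set [set h i | i in V] | V : {set 'I_m} in Q].
pose H' (P : {set {set 'I_n}}) := [set h @^-1: V | V : {set 'I_n} in P].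
have hK (V : {set 'I_m}) : h @^-1: (h @: V) = V.
  by apply/setP => i; rewrite inE mem_imset.
have HK Q : H' (H Q) = Q.
  by rewrite /H' /H -imset_comp (eq_imset (g := id)) ?imset_id.
rewrite [RHS](reindex_onto H H').
  apply: eq_big => [Q|Q QNC].
    rewrite HK eqxx andbT inE /NCset noncrossing_imset; congr (_ && _).
    by rewrite imset_partition.
  by rewrite big_imset //= => V W _ _; exact: imset_inj.
move=> P /andP[Pp _]; rewrite /H /H' -imset_comp.
rewrite -[RHS]imset_id; apply: eq_in_imset => V VP /=.
apply/setP => i; apply/imsetP/idP => [[j]|iV]; first by rewrite inE => ? ->.
have /subsetP/(_ _ iV)/imsetP[j _ ij] := partitionS Pp VP.
by exists j; rewrite // inE -ij.
Qed.

End Transport.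

(** * Moments of subwords as sums over noncrossing partitions *)

Section PartialMoments.
Context {C : numClosedFieldType} {A : starAlgType C} (psi : A -> C).

(** Comparing lists of letters avoids casts between ordinal types whose sizes are only provably
    equal. *)
Lemma kappa_enum n m (chi : 'I_n -> side) (a : 'I_n -> A)
    (chi' : 'I_m -> side) (a' : 'I_m -> A) :
  [seq (chi i, a i) | i <- enum 'I_n] = [seq (chi' i, a' i) | i <- enum 'I_m] ->
  kappa psi chi a = kappa psi chi' a'.
Proof.
move=> e; have := congr1 size e; rewrite size_map size_enum_ord size_map size_enum_ord => nm.
case: _ / nm chi' a' e => chi' a' /eq_in_map e.
by congr kappa; apply: funext => i; have [] := e i (mem_enum _ _).
Qed.

Variables (n : nat) (chi : 'I_n -> side) (a : 'I_n -> A).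

Definition block_kappa (V : {set 'I_n}) : C := kappa psi (restr V chi) (restr V a).

Lemma kappa_restr_restr (E : {set 'I_n}) (V : {set 'I_#|E|}) :
  kappa psi (restr V (restr E chi)) (restr V (restr E a)) =
  block_kappa [set enum_val i | i in V].
Proof.
apply: kappa_enum.
pose g i := (chi i, a i).
rewrite (map_comp g (fun j => enum_val (enum_val j))).
rewrite (map_comp (fun j : 'I_#|E| => enum_val j) (fun j : 'I_#|V| => enum_val j)).
rewrite map_enum_val -enum_imset_enum_val.
by rewrite [RHS](map_comp g) map_enum_val.
Qed.

Hypothesis psi1 : psi 1 = 1.

(** The moment-cumulant formula for the restriction to the image of [E]. Via [chi_lift],
    bi-non-crossing partitions of the restriction become noncrossing partitions of [E], with places
    counted in the order [s_chi]. *)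
Lemma partial_moment_cumulant (E : {set 'I_n}) :
  psi (\prod_(i <- enum [set s_chi chi i | i in E]) a i) =
  \sum_(P | NCset E P) \prod_(V in P) block_kappa [set s_chi chi i | i in V].
Proof.
set sE := [set s_chi chi i | i in E].
have [E0|[x xE]] := set_0Vmem E.
  (* For empty [E] both sides are 1: the empty word, and the empty partition with its empty
     product. *)
  have -> : enum sE = [::].
    by apply: size0nil; rewrite -cardE /sE E0 imset0 cards0.
  rewrite big_nil psi1 (eq_bigl (pred1 set0)); last first.
    move=> P; rewrite /NCset E0 partition_set0 /=.
    apply: andb_idr => /eqP ->; apply/noncrossingP => V W; by rewrite inE.
  by rewrite big_pred1_eq big_set0.
have sE0 : (0 < #|sE|)%N by apply/card_gt0P; exists (s_chi chi x); exact: imset_f.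
have -> : \prod_(i <- enum sE) a i = \prod_(j < #|sE|) restr sE a j.
  by rewrite big_ord_enum -map_enum_val big_map.
rewrite (moment_cumulant psi (restr sE chi)) //.
rewrite (_ : \sum_(P | NCset E P) _ =
    \sum_(P | NCset [set chi_lift j | j in [set: 'I_#|sE|]] P)
      \prod_(V in P) block_kappa [set s_chi chi i | i in V]); last first.
  by apply: eq_bigl => P; congr NCset; apply/setP => i; exact: mem_chi_lift.
rewrite -(sum_NC_imset (@chi_lift_lt _ _ _)
  (fun V => block_kappa [set s_chi chi i | i in V])).
have sinj := @perm_inj _ (s_chi (restr sE chi)).
rewrite /BNC big_imset /=; last by move=> P Q _ _; apply/imset_inj/imset_inj.
apply: eq_bigr => P _; rewrite big_imset /=; last by move=> V W _ _; exact: imset_inj.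
by apply: eq_bigr => V _; rewrite s_chi_lift_imset -kappa_restr_restr.
Qed.

End PartialMoments.

(** * The R-diagonal shape of a word and of its subwords *)

(** In the order [s_chi] the left letters always come before the right ones, so k can be taken to be
    the number of left letters; only parity and alternation remain. *)
Lemma shape_top n (chi : 'I_n -> side) (e : 'I_n -> bool) :
  R_diagonal_shape chi e <->
  ~~ odd n /\ forall i j : 'I_n, j = i.+1 :> nat ->
    e (s_chi chi i) != e (s_chi chi j).
Proof.
split=> [[ev [k [w [_ alt _ we]]]]|[ev alt]].
  by split=> // i j /alt; rewrite !we.
split=> //; exists (size [seq i <- enum 'I_n | is_lft (chi i)]).
exists (fun i => e (s_chi chi i)); split=> // [|i].
  by rewrite size_filter (leq_trans (count_size _ _)) // size_enum_ord.
rewrite permE /chi_seq nth_cat; case: ltnP => ik.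
  by have := mem_nth i ik; rewrite mem_filter => /andP[]; case: (chi _).
set s := rev _; set t := (_ - _)%N.
have : nth i s t \in s.
  apply: mem_nth; rewrite /t ltn_subLR //.
  by rewrite -size_cat [size _](size_chi_seq chi).
by rewrite mem_rev mem_filter => /andP[]; case: (chi _).
Qed.

(** Consecutive elements of [E] are lifts of successive indices, since a skipped index would lift to
    an element strictly between them. *)
Lemma shape_restr n (chi : 'I_n -> side) (e : 'I_n -> bool) (E : {set 'I_n}) :
  let sE := [set s_chi chi i | i in E] in
  R_diagonal_shape (restr sE chi) (restr sE e) ->
  ~~ odd #|E| /\ forall i j, consecutive E i j ->
    e (s_chi chi i) != e (s_chi chi j).
Proof.
move=> sE /shape_top[ev alt]; split.
  by move: ev; rewrite card_imset //; exact: perm_inj.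
move=> i j [].
rewrite {1}(mem_chi_lift chi) => /imsetP[p _ ->].
rewrite {1}(mem_chi_lift chi) => /imsetP[q _ ->] pq gap.
rewrite !s_chi_lift; apply: alt.
have ltpq : (p < q)%N.
  by case: (ltngtP p q) pq => [//|/(chi_lift_lt (chi := chi))/ltnW|/val_inj ->];
    [rewrite leqNgt => /negPf -> | rewrite ltnn].
apply/eqP; rewrite eqn_leq ltpq andbT leqNgt; apply/negP => p1q.
have p1 : (p.+1 < #|sE|)%N by exact: leq_trans p1q (ltnW (ltn_ord q)).
have := gap (chi_lift (Ordinal p1)).
rewrite {1}(mem_chi_lift chi) imset_f ?inE // => /(_ isT) /negP[].
by rewrite !chi_lift_lt.
Qed.

(** * Cutting a word into maximal alternating segments *)

HB.instance Definition _ := gen_eqMixin pword.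

Notation letter := (side * bool)%type.

Definition letters (w : pword) : seq letter :=
  [seq (lft, b) | b <- xs w] ++ [seq (rgt, b) | b <- ys w].

Definition exps (w : pword) := xs w ++ ys w.

Lemma map_letters w : [seq l.2 | l <- letters w] = exps w.
Proof. by rewrite map_cat -!map_comp !map_id. Qed.

Definition alternating : seq bool -> bool := sorted (fun a b => a != b).

(** Equal exponents meet at each junction, so the words are the maximal alternating segments of
    their concatenation. This is the matching of indices in $p_{i_1,i_2}p_{i_2,i_3}\cdots$. *)
Definition chained (ws : seq pword) : bool :=
  all (fun w => alternating (exps w) && (exps w != [::])) ws &&
  sorted (fun v w => last false (exps v) == head false (exps w)) ws.

(** A pairwise form of the disjunction of the two conditions in the theorem. *)
Definition x_before_y (ws : seq pword) : bool :=
  pairwise (fun v w => nilp (ys v) || nilp (xs w)) ws.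

Lemma alternating_nth s t : alternating s -> (t < size s)%N ->
  nth false s t = head false s (+) odd t.
Proof.
elim: t s => [|t IH] [|b [|b' s]] //=; rewrite ?addbF // => /andP[bb' alt] ts.
rewrite -[nth _ _ _]/(nth false (b' :: s) t) IH //=.
by move: bb'; clear; case: b; case: b'; case: odd.
Qed.

Lemma alternating_last s : alternating s -> s != [::] ->
  last false s = head false s (+) ~~ odd (size s).
Proof.
move=> alt s0; rewrite -nth_last alternating_nth //; last by case: s s0 {alt}.
by case: s s0 {alt} => //= b s _; rewrite negbK.
Qed.

Lemma chained_cons b v w ws : exps v = [:: b] ->
  chained (w :: ws) -> b = head false (exps w) -> chained (v :: w :: ws).
Proof.
rewrite /chained => e /andP[al so] bh.
by rewrite /= e bh eqxx /=; apply/andP.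
Qed.

Lemma chained_merge b v w ws : exps v = b :: exps w -> chained (w :: ws) ->
  b != head false (exps w) -> chained (v :: ws).
Proof.
rewrite /chained => e /andP[/= /andP[/andP[alt ne] al] so] bh.
rewrite e al andbT /=; apply/andP; split.
  rewrite andbT /alternating; move: alt ne bh.
  by case: (exps w) => //= c s -> _ ->.
case: ws so {al} => //= v' ws; rewrite e.
by case: (exps w) ne => //= c s _.
Qed.

(** Once a word contains a letter y, all later words have no letter x. *)
Lemma x_before_y_letters ws : x_before_y ws ->
  flatten [seq letters w | w <- ws] =
  [seq (lft, b) | b <- flatten [seq xs w | w <- ws]] ++
  [seq (rgt, b) | b <- flatten [seq ys w | w <- ws]].
Proof.
elim: ws => //= w ws IH /andP[/allP wws /IH ->].
rewrite !map_cat /letters.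
have [/nilP ->|yw] := boolP (nilp (ys w)); first by rewrite cats0 catA.
rewrite (_ : flatten [seq xs w | w <- ws] = [::]) /= ?cats0 ?catA //.
have {}wws v : v \in ws -> xs v = [::].
  by move=> /wws; rewrite (negPf yw) => /nilP.
elim: ws wws {IH} => //= v ws IH h; rewrite h ?mem_head //= IH // => u uws.
by apply: h; rewrite inE uws orbT.
Qed.

(** Built from the right: a new letter forms its own word if its exponent equals the next one, and
    otherwise joins the word that follows. The last clause serves the induction on [q], where a
    letter y may only join a word without x. *)
Lemma chained_decomposition (p q : seq bool) : p ++ q != [::] ->
  exists ws, [/\ ws != [::], chained ws, x_before_y ws,
    flatten [seq letters w | w <- ws] =
      [seq (lft, b) | b <- p] ++ [seq (rgt, b) | b <- q] &
    p = [::] -> all (fun w => nilp (xs w)) ws].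
Proof.
elim: p => [|b p IH] /=.
  elim: q => //= b q IH _; have [q0|q0] := eqVneq q [::].
    by exists [:: PWord [::] [:: b]]; rewrite q0.
  have [[|w ws] []] // := IH q0.
  move=> _ ch xy le /(_ erefl) /= /andP[/nilP xw xws].
  have [bw|bw] := eqVneq b (head false (exps w)).
    exists [:: PWord [::] [:: b], w & ws]; split=> //.
    - exact: chained_cons bw.
    - rewrite /x_before_y /= in xy *; rewrite xy andbT xw /=.
      exact: xws.
    - by rewrite /= in le *; rewrite le.
    - by rewrite /= xw.
  exists (PWord [::] (b :: ys w) :: ws); split=> //.
  - by apply: chained_merge bw => //; rewrite /exps xw.
  - move: xy; rewrite /x_before_y /= => /andP[_ ->].
    by rewrite andbT; exact: xws.
  - by move: le; rewrite /= /letters xw /= => ->.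
move=> _; have [pq0|pq0] := eqVneq (p ++ q) [::].
  exists [:: PWord [:: b] [::]]; split=> //.
  by case: p pq0 {IH} => //= ->.
have [[|w ws] []] // := IH pq0; move=> _ ch xy le _.
have [bw|bw] := eqVneq b (head false (exps w)).
  exists [:: PWord [:: b] [::], w & ws]; split=> //.
  - exact: chained_cons bw.
  - by move: xy; rewrite /x_before_y /= => ->; rewrite all_predT.
  - by rewrite /= in le *; rewrite le.
exists (PWord (b :: xs w) (ys w) :: ws); split=> //.
- exact: chained_merge bw.
- by move: le; rewrite /= => <-.
Qed.

(** * Places in a concatenation of lists *)

Section Concatenation.
Variables (T : Type) (s : seq (seq T)).

Definition offset j := size (flatten (take j s)).

Lemma flatten_take j : (j < size s)%N ->
  flatten (take j.+1 s) = flatten (take j s) ++ nth [::] s j.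
Proof. by move=> js; rewrite (take_nth [::]) // flatten_rcons. Qed.

Lemma offset0 : offset 0 = 0%N.
Proof. by rewrite /offset take0. Qed.

Lemma offset_size : offset (size s) = size (flatten s).
Proof. by rewrite /offset take_size. Qed.

Lemma offsetS j : (j < size s)%N -> offset j.+1 = (offset j + size (nth [::] s j))%N.
Proof. by move=> js; rewrite /offset flatten_take // size_cat. Qed.

Lemma offset_mono : {homo offset : i j / (i <= j)%N >-> (i <= j)%N}.
Proof.
apply: homo_leq => [//|? ? ?|j]; first exact: leq_trans.
have [js|sj] := ltnP j (size s); first by rewrite offsetS // leq_addr.
by rewrite /offset !take_oversize // ltnW.
Qed.

Lemma nth_flatten_offset d j t : (j < size s)%N -> (t < size (nth [::] s j))%N ->
  nth d (flatten s) (offset j + t) = nth d (nth [::] s j) t.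
Proof.
move=> js tj; rewrite -{1}(cat_take_drop j s) flatten_cat nth_cat.
rewrite ltnNge leq_addr /= addKn (drop_nth [::]) //=.
by rewrite nth_cat tj.
Qed.

Lemma prod_offset (A : pzRingType) (F : T -> A) d j : (j < size s)%N ->
  \prod_(offset j <= i < offset j.+1) F (nth d (flatten s) i) =
  \prod_(l <- nth [::] s j) F l.
Proof.
move=> js; rewrite offsetS // [RHS](big_nth d) -{1}[offset j]add0n big_addn.
rewrite addKn; apply: eq_big_nat => t /andP[_ tj].
by rewrite addnC nth_flatten_offset.
Qed.

End Concatenation.

(** Passing a word of length l changes the first exponent iff l + 1 is odd; the extra 1 comes from
    the repeated exponent at the junction and accounts for the summand [j]. *)
Lemma chained_parity ws j : chained ws -> (j < size ws)%N ->
  head false (exps (nth (PWord [::] [::]) ws j)) =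
  head false (exps (nth (PWord [::] [::]) ws 0)) (+)
    odd (offset [seq exps w | w <- ws] j + j).
Proof.
move=> /andP[/allP ok so]; elim: j => [|j IH] jr.
  by rewrite offset0 addbF.
set w0 := PWord _ _ in IH *.
have /andP[alt ne] := ok _ (mem_nth w0 (ltnW jr)).
have := sortedP w0 so j jr => /eqP <-.
rewrite alternating_last // IH ?(ltnW jr) // offsetS ?size_map ?(ltnW jr) //.
rewrite (nth_map w0) ?(ltnW jr) // addnS /= !oddD; clear.
by case: head; do 3!case: odd.
Qed.

Definition letter_val (R : numClosedFieldType) (A : starAlgType R) (x y : A)
    (l : letter) : A :=
  spow (if is_lft l.1 then x else y) l.2.

Lemma word_valE (R : numClosedFieldType) (A : starAlgType R) (x y : A) w :
  word_val x y w = \prod_(l <- letters w) letter_val x y l.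
Proof. by rewrite big_cat !big_map. Qed.

(** The value [P_val], with centring decided by the parity of the length rather than by the two
    indices. *)
Definition centered (R : numClosedFieldType) (A : starAlgType R) (phi : A -> R)
    (x y : A) (w : pword) : A :=
  if odd (size (exps w)) then word_val x y w
  else word_val x y w - (phi (word_val x y w))%:A.

(** * Cumulants as values of centred products *)

Section KappaCentered.
Context {C : numClosedFieldType} {A B : starAlgType C}.
Variables (phi : A -> C) (psi : B -> C) (x y : A) (X Y : B).
Hypothesis phi_scalar : scalar phi.
Hypothesis psi1 : psi 1 = 1.
Variables (n : nat) (chi : 'I_n -> side) (e : 'I_n -> bool).

Let z (i : 'I_n) : B := letter_val X Y (chi i, e i).
Let u (i : 'I_n) : A := letter_val x y (chi i, e i).

Hypothesis moments : forall E : {set 'I_n},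
  psi (\prod_(i <- enum E) z i) = phi (\prod_(i <- chi_seq chi | i \in E) u i).
Hypothesis vanish : forall E : {set 'I_n}, E != [set: 'I_n] ->
  ~ R_diagonal_shape (restr E chi) (restr E e) -> block_kappa psi chi z E = 0.

Variable ws : seq pword.
Hypothesis ws_chained : chained ws.
Hypothesis ws_letters :
  flatten [seq letters w | w <- ws] = [seq (chi i, e i) | i <- chi_seq chi].
Hypothesis ws_nontrivial : ~~ ((size ws == 1%N) && ~~ odd n).
Hypothesis ws_neq0 : ws != [::].

(** An instance of [top_cumulant]: the cuts are the offsets of the words, and [f V] is the cumulant
    of the letters at the places [V] in the order [s_chi]. *)
Lemma kappa_centered : kappa psi chi z = phi (\prod_(w <- ws) centered phi x y w).
Proof.
pose L := [seq letters w | w <- ws].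
pose d : letter := (lft, false); pose w0 := PWord [::] [::].
pose c := offset L; pose a i := letter_val x y (nth d (flatten L) i).
pose f (V : {set 'I_n}) := block_kappa psi chi z [set s_chi chi i | i in V].
have sizeL : size (flatten L) = n by rewrite ws_letters size_map size_chi_seq.
have nthL (i : 'I_n) :
    nth d (flatten L) i = (chi (s_chi chi i), e (s_chi chi i)).
  by rewrite ws_letters (nth_map i) ?size_chi_seq // permE.
have cE : offset [seq exps w | w <- ws] =1 c.
  move=> j; rewrite /c /offset -!map_take !size_flatten /shape -!map_comp.
  congr sumn; apply: eq_map => w /=.
  by rewrite -map_letters size_map.
have size_exps j : (j < size ws)%N ->
    size (nth [::] L j) = size (exps (nth w0 ws j)).
  by move=> jr; rewrite (nth_map w0) // -map_letters size_map.
have [/allP ok _] := andP ws_chained.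
have c_lt j : (j < size ws)%N -> (c j < c j.+1)%N.
  move=> jr; rewrite /c offsetS ?size_map // -[X in (X < _)%N]addn0 ltn_add2l.
  rewrite size_exps // lt0n size_eq0.
  by have /andP[] := ok _ (mem_nth w0 jr).
have cr : c (size ws) = n by rewrite -sizeL -offset_size size_map.
have <- : f [set: 'I_n] = kappa psi chi z.
  rewrite /f /block_kappa.
  suff -> : [set s_chi chi i | i in [set: 'I_n]] = [set: 'I_n] by exact: kappa_setT.
  apply/setP => i; rewrite inE; apply/imsetP.
  by exists ((s_chi chi)^-1%g i); rewrite ?inE // permKV.
rewrite -(@top_cumulant _ _ phi phi_scalar n (size ws) c a f _ cr _ c_lt _
  (fun i => e (s_chi chi i)) (head false (exps (nth w0 ws 0)))) //.
- congr phi; rewrite [RHS](big_nth w0); apply: eq_big_nat => j /andP[_ jr].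
  have -> : seg_prod c a j = word_val x y (nth w0 ws j).
    by rewrite /seg_prod prod_offset ?size_map // (nth_map w0) // -word_valE.
  by rewrite /centered /c offsetS ?size_map // addKn size_exps.
- exact: offset0.
- exact: offset_mono.
- move=> E; rewrite -partial_moment_cumulant // moments chi_seqE big_map.
  rewrite big_ord_enum; congr phi; apply: eq_big => [i|i _].
    by rewrite mem_imset //; exact: perm_inj.
  by rewrite /a nthL.
- move=> i.
  have [j jr /andP[ji ij]] := segment_cover (offset0 L) cr (ltn_ord i).
  rewrite (seg_indexE (offset_mono L) jr) ?ji //.
  have -> : e (s_chi chi i) = (nth d (flatten L) i).2 by rewrite nthL.
  have tj : (i - c j < size (nth [::] L j))%N.
    by rewrite ltn_subLR // -offsetS ?size_map.
  rewrite -(subnKC ji) nth_flatten_offset ?size_map //.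
  rewrite -(nth_map d false (fun l => l.2)) // (nth_map w0) // map_letters.
  have /andP[alt _] := ok _ (mem_nth w0 jr).
  (* The exponent at place i is the first exponent of its word, given by [chained_parity], shifted
     by the parity of the place within the word. *)
  rewrite alternating_nth -?size_exps // chained_parity // cE.
  by rewrite -addbA -oddD addnAC.
- move=> V VT fV.
  have [|nsh] := pselect (R_diagonal_shape (restr [set s_chi chi i | i in V] chi)
    (restr [set s_chi chi i | i in V] e)); first exact: shape_restr.
  case/eqP: fV; apply: vanish => //.
  apply: contraNneq VT => sV; rewrite eqEcard subsetT cardsT card_ord /=.
  by rewrite -(card_imset _ (@perm_inj _ (s_chi chi))) sV cardsT card_ord.
- by rewrite lt0n size_eq0.
Qed.

End KappaCentered.

(* Words presenting elements of P_{i,j} begin with a star iff i = 1 and end with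
   a star iff j = 1. *)
Definition idx_star (i : idx) : bool := if i is Defs.one then true else false.

(** An alternating word ends with the exponent it begins with iff its length is odd, so the two end
    exponents determine the parity; a nonempty word of even length has at least 2 letters. *)
Lemma in_P_alternating i j w : in_P i j w <->
  [/\ alternating (exps w), exps w != [::],
      head false (exps w) = idx_star i &
      last false (exps w) = idx_star j].
Proof.
rewrite /in_P -/(exps w) -/(alternating (exps w)); split.
  move=> [alt h].
  have ne : exps w != [::].
    by case: i j h => [] [] []; case: (exps w).
  split; rewrite ?alternating_last //.
    by case: i j h => [] [] [].
  case: i j h => [] [] [].
  - by move=> -> ->.
  - by move=> /negPf -> _ ->.
  - by move=> /negPf -> _ ->.
  - by move=> -> ->.
case=> alt ne hi hj; split=> //; move: hj; rewrite alternating_last // hi.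
have : (0 < size (exps w))%N by rewrite lt0n size_eq0.
case: i j {hi} => [] []; case s_odd: (odd _) => // s0 _; split=> //;
  by move: s_odd s0; case: size => [|[|k]].
Qed.

Lemma P_val_centered (R : numClosedFieldType) (A : starAlgType R) (phi : A -> R)
    (x y : A) i j w : in_P i j w -> P_val phi x y i j w = centered phi x y w.
Proof.
rewrite /centered /in_P -/(exps w) => -[_].
by case: i j => [] [] [] => [->|/negPf ->|/negPf ->|->].
Qed.

(** * The products of the theorem as chains of words *)

(** The words determine the indices, so matching of indices turns into [chained], and the two
    conditions turn into [x_before_y]. *)
Lemma centered_products_eq0 (R : numClosedFieldType) (A : starAlgType R)
    (phi : A -> R) (x y : A) :
  (forall (n : nat) (i : nat -> idx) (w : nat -> pword),
     (2 <= n)%N ->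
     (forall k, (1 <= k < n)%N -> in_P (i k) (i k.+1) (w k)) ->
     (exists m : nat,
        [/\ (m <= n.-1)%N,
            forall k, (1 <= k <= m)%N -> only_x (w k) &
            forall k, (m < k < n)%N -> only_y (w k)]) \/
     (exists m : nat,
        [/\ (1 <= m <= n.-1)%N,
            forall k, (1 <= k < m)%N -> only_x (w k),
            both_xy (w m) &
            forall k, (m < k < n)%N -> only_y (w k)]) ->
     phi (\prod_(1 <= k < n) P_val phi x y (i k) (i k.+1) (w k)) = 0) <->
  (forall ws, ws != [::] -> chained ws -> x_before_y ws ->
     phi (\prod_(w <- ws) centered phi x y w) = 0).
Proof.
split=> [h ws ws0 /andP[/allP ok so] xy|h n i w n2 wP xyP].
  pose d := PWord [::] [::]; pose n := (size ws).+1.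
  pose w k := nth d ws k.-1.
  (* Words are numbered from 1: [i 1] is read from the first exponent of the first word, and [i k]
     for k >= 2 from the last exponent of the word k - 1. *)
  pose i k := if (if k is k'.+2 then last false (exps (nth d ws k'))
                  else head false (exps (nth d ws 0))) then Defs.one else Defs.two.
  have wP k : (1 <= k < n)%N -> in_P (i k) (i k.+1) (w k).
    case: k => // k; rewrite ltnS => /= kn.
    have /andP[alt ne] := ok _ (mem_nth d kn).
    apply/in_P_alternating; split=> //; rewrite /w /i /=; last by case: last.
    case: k kn {alt ne} => [|k] kn; first by case: head.
    by rewrite -(eqP (sortedP d so k kn)); case: last.
  have -> : \prod_(w <- ws) centered phi x y w =
            \prod_(1 <= k < n) P_val phi x y (i k) (i k.+1) (w k).
    rewrite (big_nth d) big_add1 /=; apply: eq_big_nat => k /andP[_ kn].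
    by rewrite P_val_centered //; apply: wP.
  apply: h => //; first by rewrite ltnS lt0n size_eq0.
  have {}xy j k : (j < k < size ws)%N ->
      ys (nth d ws j) = [::] \/ xs (nth d ws k) = [::].
    move=> /andP[jk kn]; have := pairwiseP d xy j k.
    rewrite !inE => /(_ (ltn_trans jk kn) kn jk).
    by case/orP => /nilP; [left | right].
  (* [m] counts the words before the first one with a letter y. If there is no such word, or it has
     no letter x, the first condition holds with [m]; otherwise the second holds with [m.+1]. *)
  pose m := find (fun w => ~~ nilp (ys w)) ws.
  have m_le : (m <= size ws)%N by exact: find_size.
  have xm j : (j < m)%N -> ys (nth d ws j) = [::].
    by move=> /(before_find d)/negbFE/nilP.
  have [mw|wm] := ltnP m (size ws); last first.
    left; exists m; split=> // k.
      by case: k => // k /= km; exact: xm.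
    by case: k => // k; rewrite ltnS => /andP[mk kn]; lia.
  have ym : ys (nth d ws m) != [::].
    have /(nth_find d) : has (fun w => ~~ nilp (ys w)) ws by rewrite has_find.
    by apply: contraNneq; rewrite -/m => ->.
  have ym' k : (m < k < size ws)%N -> xs (nth d ws k) = [::].
    by case/xy => // /eqP; rewrite (negPf ym).
  have [xm0|xm0] := eqVneq (xs (nth d ws m)) [::].
    left; exists m; split=> // -[|k] //=; first exact: xm.
    rewrite !ltnS leq_eqVlt => /andP[/orP[/eqP <- _|mk kn]].
      exact: xm0.
    by apply: ym'; rewrite mk.
  right; exists m.+1; split=> //.
  - by move=> [|k] //=; rewrite ltnS; exact: xm.
  - by split; apply/eqP.
  - by move=> [|k] //=; rewrite !ltnS; exact: ym'.
have -> : \prod_(1 <= k < n) P_val phi x y (i k) (i k.+1) (w k) =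
          \prod_(v <- [seq w k | k <- index_iota 1 n]) centered phi x y v.
  by rewrite big_map; apply: eq_big_nat => k kn; rewrite P_val_centered //; exact: wP.
have nthw k : (k < n.-1)%N ->
    nth (w 0) [seq w k | k <- index_iota 1 n] k = w k.+1.
  by move=> kn; rewrite (nth_map 0%N) ?size_iota ?subn1 // nth_iota ?subn1.
apply: h.
- by rewrite -size_eq0 size_map size_iota; lia.
- apply/andP; split.
    apply/allP => _ /mapP[k + ->]; rewrite mem_index_iota => /wP.
    by case/in_P_alternating => -> ->.
  apply/(sortedP (w 0)) => k; rewrite size_map size_iota subn1 => kn.
  rewrite !nthw ?(ltnW kn) //.
  have /in_P_alternating[_ _ _ ->] := wP k.+1 ltac:(lia).
  by have /in_P_alternating[_ _ -> _] := wP k.+2 ltac:(lia).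
- apply/(pairwiseP (w 0)) => j k; rewrite !inE size_map size_iota subn1 => jn kn jk.
  rewrite !nthw //; case: xyP => -[m [mn h1 h2]].
    have [jm|mj] := ltnP j m; first by rewrite (h1 j.+1) ?orTb //= jm.
    by rewrite [X in _ || X](_ : _ = true) ?orbT // h2 //; lia.
  move=> h3.
  have [jm|mj] := ltnP j.+1 m; first by rewrite (h1 j.+1) // jm.
  by rewrite [X in _ || X](_ : _ = true) ?orbT // h3 //; lia.
Qed.

(** * Words given by [chi] and exponents *)

Lemma star1 (C : numClosedFieldType) (A : starAlgType C) : star (1 : A) = 1.
Proof. by rewrite -[RHS]starK -[star 1 in RHS]mulr1 starM starK mulr1. Qed.

Lemma nth_map_ord n (T : Type) (d : T) (F : 'I_n -> T) (i : 'I_n) :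
  nth d [seq F j | j <- enum 'I_n] i = F i.
Proof. by rewrite (nth_map i) ?size_enum_ord // nth_ord_enum. Qed.

Lemma shape_alternating n (chi : 'I_n -> side) (e : 'I_n -> bool) :
  R_diagonal_shape chi e <->
  ~~ odd n /\ alternating [seq e i | i <- chi_seq chi].
Proof.
split=> /= [/shape_top[ev alt]|[ev alt]].
  split=> //; rewrite chi_seqE -map_comp; apply/(sortedP false) => k.
  rewrite size_map size_enum_ord => kn.
  rewrite [X in X != _](nth_map_ord false _ (Ordinal (ltnW kn))).
  rewrite [X in _ != X](nth_map_ord false _ (Ordinal kn)).
  exact: alt.
apply/shape_top; split=> // i j ij.
move: alt; rewrite chi_seqE -map_comp => /(sortedP false)/(_ i).
rewrite size_map size_enum_ord -ij => /(_ (ltn_ord j)).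
by rewrite !nth_map_ord.
Qed.

(** A junction of two words repeats an exponent, which breaks alternation. *)
Lemma chained_alternating ws : chained ws ->
  alternating (flatten [seq exps w | w <- ws]) -> (size ws <= 1)%N.
Proof.
case: ws => [|v [|w ws]] //= /andP[/= /and3P[/andP[_ nv] /andP[_ nw] _]].
move=> /andP[lvhw _]; rewrite /alternating.
case: (exps v) nv lvhw => //= b s _; case: (exps w) nw => //= b' s' _ lb.
by rewrite cat_path /= lb andbF.
Qed.

Lemma chi_seq_partition n (chi : 'I_n -> side) (e : 'I_n -> bool) :
  [seq (chi i, e i) | i <- chi_seq chi] =
  [seq (lft, e i) | i <- [seq i <- enum 'I_n | is_lft (chi i)]] ++
  [seq (rgt, e i) | i <- rev [seq i <- enum 'I_n | ~~ is_lft (chi i)]].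
Proof.
rewrite /chi_seq map_cat; congr (_ ++ _); apply/eq_in_map => i.
  by rewrite mem_filter; case: (chi i).
by rewrite mem_rev mem_filter; case: (chi i).
Qed.

(** The left letters are listed first and the right ones after them in reverse; reading in the order
    [s_chi] undoes the reversal. *)
Lemma chi_of_letters (p q : seq bool) :
  exists (chi : 'I_(size (p ++ q)) -> side) (e : 'I_(size (p ++ q)) -> bool),
    [seq (chi i, e i) | i <- chi_seq chi] =
    [seq (lft, b) | b <- p] ++ [seq (rgt, b) | b <- q].
Proof.
pose s : seq letter := [seq (lft, b) | b <- p] ++ rev [seq (rgt, b) | b <- q].
have sz : size s = size (p ++ q) by rewrite !size_cat size_rev !size_map.
rewrite -sz; pose d : letter := (lft, false).
exists (fun i : 'I_(size s) => (nth d s i).1), (fun i : 'I_(size s) => (nth d s i).2).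
pose g (i : 'I_(size s)) := nth d s i.
have gE (r : seq 'I_(size s)) :
    [seq ((nth d s i).1, (nth d s i).2) | i : 'I_(size s) <- r] = [seq g i | i <- r].
  by apply: eq_map => i; rewrite -surjective_pairing.
have enum_s : [seq g i | i <- enum 'I_(size s)] = s.
  rewrite (map_comp (nth d s) val) val_enum_ord.
  by apply: (@eq_from_nth _ d); rewrite ?size_map ?size_iota // => k ks;
    rewrite (nth_map 0%N) ?size_iota // nth_iota.
rewrite gE /chi_seq map_cat map_rev.
rewrite -(filter_map g (fun l => is_lft l.1)).
rewrite -(filter_map g (fun l => ~~ is_lft l.1)) enum_s.
rewrite /s !filter_cat !filter_rev !filter_map.
rewrite (eq_filter (a2 := predT)) // filter_predT.
rewrite (eq_filter (a2 := pred0)) // filter_pred0.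
rewrite (eq_filter (a2 := pred0)) // filter_pred0.
rewrite (eq_filter (a2 := predT)) // filter_predT.
by rewrite cats0 /= revK.
Qed.

(** * Moments of left and right multiplications *)

Section StandardForm.
Import Order.TTheory Num.Theory numFieldNormedType.Exports.
Context {R : realType} {H : hilbertType R} {A : vonNeumann H}.
Variables (phi : A -> R[i]) (K : hilbertType R) (iota : A -> K).
Hypothesis phi_state : is_state phi.
Hypothesis phi_tracial : is_tracial phi.
Hypothesis K_L2 : is_L2 phi iota.
Variables (Lm Rm : A -> bop K).
Hypotheses (LmP : left_mult iota Lm) (RmP : right_mult iota Rm).

Let phi_scalar : scalar phi. Proof. by case: phi_state. Qed.
Let phi1 : phi 1 = 1. Proof. by case: phi_state. Qed.
Let inner_iota S T : inner (iota S) (iota T) = phi (star T * S).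
Proof. by case: K_L2. Qed.

(** The difference [d] is orthogonal to every [iota b]. By density some [iota b] satisfies |d - iota
    b| < |d|, whereas Cauchy-Schwarz for d - iota b and d gives |d|^2 <= |d - iota b| |d|. *)
Lemma inner_iota_ext (u v : K) :
  (forall b, inner (iota b) u = inner (iota b) v) -> u = v.
Proof.
move=> uv; apply/eqP; rewrite -subr_eq0; apply/negPn/negP => d0.
set d := u - v in d0.
have orth b : inner (iota b) d = 0 by rewrite innerBr uv subrr.
case: K_L2 => _ _ dn.
have nd : 0 < `|d| by rewrite normr_gt0.
have [||z [zB [b _ zb]]] := dn (ball d `|d|).
- by exists d; apply: ballxx.
- exact: ball_open.
move: zB; rewrite -ball_normE /= -zb => lt1.
have := cauchy_schwarz d (d - iota b).
rewrite innerBl orth subr0 inner_norm normrX normr_id.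
by rewrite expr2 ler_pM2r // (lt_geF lt1).
Qed.

Lemma star_left_mult x b : star (Lm x) (iota b) = iota (star x * b).
Proof.
apply: inner_iota_ext => c; rewrite -[star (Lm x)]/(adjoint (Lm x)) -adjointP.
by rewrite LmP !inner_iota starM starK mulrA.
Qed.

(** Traciality moves [y] from the right end of the product to the left, where it becomes part of the
    adjoint of b * star y. *)
Lemma star_right_mult y b : star (Rm y) (iota b) = iota (b * star y).
Proof.
apply: inner_iota_ext => c; rewrite -[star (Rm y)]/(adjoint (Rm y)) -adjointP.
by rewrite RmP !inner_iota starM starK mulrA phi_tracial mulrA.
Qed.

Lemma letter_val_iota x y (l : letter) b :
  letter_val (Lm x) (Rm y) l (iota b) =
  iota (if is_lft l.1 then letter_val x y l * b else b * letter_val x y l).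
Proof.
case: l => [[] []]; rewrite /letter_val /=.
- exact: star_left_mult.
- exact: LmP.
- exact: star_right_mult.
- exact: RmP.
Qed.

Lemma vector_state1 : vector_state (iota 1) 1 = 1.
Proof. by rewrite /vector_state bop1E inner_iota mulr1 star1. Qed.

Section Moments.
Variables (x y : A) (n : nat) (chi : 'I_n -> side) (e : 'I_n -> bool).
Let z i := letter_val (Lm x) (Rm y) (chi i, e i).
Let u i := letter_val x y (chi i, e i).

(* Right multiplications act in reverse order. *)
Lemma prod_letters_iota (s : seq 'I_n) b :
  (\prod_(i <- s) z i) (iota b) =
  iota (\prod_(i <- [seq i <- s | is_lft (chi i)]) u i * b *
        \prod_(i <- rev [seq i <- s | ~~ is_lft (chi i)]) u i).
Proof.
elim: s => [|i s IH]; first by rewrite !big_nil bop1E mul1r mulr1.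
rewrite big_cons bopME IH letter_val_iota /=; congr iota.
case: (is_lft (chi i)) => /=; first by rewrite big_cons !mulrA.
by rewrite rev_cons -cats1 big_cat big_seq1 !mulrA.
Qed.

(** Acting on [iota 1], left letters accumulate in order and right letters in reverse, which is the
    order [chi_seq]. *)
Lemma moments_L2 (E : {set 'I_n}) :
  vector_state (iota 1) (\prod_(i <- enum E) z i) =
  phi (\prod_(i <- chi_seq chi | i \in E) u i).
Proof.
rewrite /vector_state prod_letters_iota inner_iota star1 mul1r mulr1.
congr phi; rewrite -[RHS]big_filter /chi_seq filter_cat filter_rev big_cat /=.
congr (_ * _); congr (\prod_(i <- _) _); rewrite ?(enum_filter E); last congr rev.
  by rewrite -[LHS]filter_predI -[RHS]filter_predI; apply: eq_filter => i; exact: andbC.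
by rewrite -[LHS]filter_predI -[RHS]filter_predI; apply: eq_filter => i; exact: andbC.
Qed.

End Moments.
End StandardForm.

(** * The equivalence *)

Lemma phi_centered_even (C : numClosedFieldType) (A : starAlgType C)
    (phi : A -> C) (x y : A) w : scalar phi -> phi 1 = 1 ->
  ~~ odd (size (exps w)) -> phi (centered phi x y w) = 0.
Proof.
move=> phi_scalar phi1 /negPf ev; rewrite /centered ev addrC -scaleNr phi_scalar.
by rewrite phi1 mulr1 addNr.
Qed.

Theorem theorem3p2 (R : realType) (H : hilbertType R) (A : vonNeumann H)
    (phi : A -> R[i]) (phi_state : is_state phi) (phi_faithful : is_faithful phi)
    (phi_normal : is_normal phi) (phi_tracial : is_tracial phi)
    (K : hilbertType R) (iota : A -> K) (K_L2 : is_L2 phi iota)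
    (Lm Rm : A -> bop K) (LmP : left_mult iota Lm) (RmP : right_mult iota Rm)
    (x y : A) :
  R_diagonal (vector_state (iota 1)) (Lm x) (Rm y) <->
  (forall (n : nat) (i : nat -> idx) (w : nat -> pword),
     (2 <= n)%N ->
     (forall k, (1 <= k < n)%N -> in_P (i k) (i k.+1) (w k)) ->
     (exists m : nat,
        [/\ (m <= n.-1)%N,
            forall k, (1 <= k <= m)%N -> only_x (w k) &
            forall k, (m < k < n)%N -> only_y (w k)]) \/
     (exists m : nat,
        [/\ (1 <= m <= n.-1)%N,
            forall k, (1 <= k < m)%N -> only_x (w k),
            both_xy (w m) &
            forall k, (m < k < n)%N -> only_y (w k)]) ->
     phi (\prod_(1 <= k < n) P_val phi x y (i k) (i k.+1) (w k)) = 0).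
Proof.
have [phi_scalar phi1 _] := phi_state.
have psi1 := vector_state1 phi_state K_L2.
have mom := moments_L2 phi_tracial K_L2 LmP RmP.
split=> [Rd|h].
  apply/centered_products_eq0 => ws ws0 wsc wsxy.
  (* A single even word is the case excluded from [kappa_centered]; there [phi] vanishes because the
     word is centred. *)
  have [[w -> evw]|nt] :=
    pselect (exists2 w, ws = [:: w] & ~~ odd (size (exps w))).
    by rewrite big_seq1 phi_centered_even.
  have [chi [e le]] := chi_of_letters (flatten [seq xs w | w <- ws])
    (flatten [seq ys w | w <- ws]).
  have lws := x_before_y_letters wsxy; rewrite -le in lws.
  have ev1 : ~~ ((size ws == 1%N) && ~~ odd (size (flatten [seq xs w | w <- ws] ++
      flatten [seq ys w | w <- ws]))).
    apply/negP => /andP[/eqP sz ev]; apply: nt.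
    case: ws sz ev {ws0 wsc wsxy lws chi e le} => [|w []] //= _.
    by rewrite !cats0 => ev; exists w.
  have := kappa_centered phi_scalar psi1 (mom x y _ chi e) _ wsc lws ev1 ws0.
  move=> <-; last by move=> E _ nsh; exact: (Rd _ (restr E chi) (restr E e) nsh).
  (* Were the shape R-diagonal, the concatenation would alternate, so the chain would be a single
     even word. *)
  apply: Rd => /shape_alternating[ev alt].
  have expsE : flatten [seq exps w | w <- ws] = [seq e i | i <- chi_seq chi].
    have := congr1 (map snd) lws; rewrite map_flatten -!map_comp => <-.
    by congr flatten; apply: eq_map => w /=; rewrite map_letters.
  rewrite -expsE in alt.
  case/negP: ev1; rewrite ev andbT eqn_leq (chained_alternating wsc alt) /=.
  by rewrite lt0n size_eq0.
(* Strong induction on the number of letters supplies the vanishing of the cumulants of proper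
   subwords. *)
move=> m; elim/ltn_ind: m => m IH chi e nsh.
(* The empty word has the R-diagonal shape. *)
have m0 : (0 < m)%N.
  by case: m chi e nsh {IH} => // chi e []; apply/shape_top; split=> // -[].
have e0 : [seq e i | i <- [seq i <- enum 'I_m | is_lft (chi i)]] ++
    [seq e i | i <- rev [seq i <- enum 'I_m | ~~ is_lft (chi i)]] != [::].
  rewrite -map_cat -size_eq0 size_map [size _](size_chi_seq chi).
  by rewrite -lt0n.
have [ws [ws0 wsc wsxy lws _]] := chained_decomposition e0.
rewrite -!map_comp -chi_seq_partition in lws.
(* A chain consisting of one even word would make the whole word even and alternating, contrary to
   [nsh]. *)
have nt : ~~ ((size ws == 1%N) && ~~ odd m).
  apply/negP => /andP[/eqP sz ev]; apply: nsh; apply/shape_alternating.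
  split=> //; have := congr1 (map snd) lws; rewrite -[map snd (map _ _)]map_comp.
  case: ws sz wsc {ws0 wsxy lws} => [|w []] //= _ /andP[/= /andP[/andP[alt _] _] _].
  by rewrite cats0 map_letters => <-.
have := kappa_centered phi_scalar psi1 (mom x y _ chi e) _ wsc lws nt ws0.
move=> ->; first by apply: (centered_products_eq0 phi x y).1.
move=> E ET nshE; apply: (IH _ _ (restr E chi) (restr E e)) => //.
rewrite -[X in (_ < X)%N]card_ord -cardsT; apply: proper_card.
by rewrite properEneq ET subsetT.
Qed.
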